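(* Let $d \in \mathbb{Z}$ with $d\neq 0$. Any faithful generically transitive action of $G_d$ on $\mathbb{P}^2$ is equivalent to either $\tau_{d,k}$ for a unique integer $k \neq 0$ with $\gcd(|k|,|d|)=1$, or $\rho_d$. Any faithful generically transitive action of $G_0$ on $\mathbb{P}^2$ is equivalent to $\tau_{0,1}$.
   Context: $K$ is an algebraically closed field of characteristic $0$; everything is over $K$. For $d\in\mathbb{Z}$, $G_d=\mathbb{G}_\mathrm{a}\rtimes\mathbb{G}_\mathrm{m}$ denotes the algebraic group with underlying variety $\mathbb{G}_\mathrm{a}\times\mathbb{G}_\mathrm{m}$ and group law $(b,t)\cdot(b',t')=(b+t^db',tt')$. All actions are left actions. An action is generically transitive if it is transitive on some dense open subset. Equivalence: if an algebraic group $G$ acts on varieties $X_1$ and $X_2$, an equivalence of these $G$-actions consists of an automorphism $\alpha:G\to G$ of algebraic groups and an isomorphism $j:X_1\to X_2$ such that $j(g\cdot x)=\alpha(g)\cdot j(x)$ for all $g\in G$, $x\in X_1$. With coordinates $(x:y:z)$ on $\mathbb{P}^2$ (matrices acting by left multiplication on column vectors), for $d\in\mathbb{Z}$ and $k\in\mathbb{Z}\setminus\{0\}$ the action $\tau_{d,k}$ of $G_d$ on $\mathbb{P}^2$ is given by $$\tau_{d,k}(b,t)=\begin{pmatrix} t^{k}&0&0\\0&t^{d}&b\\0&0&1\end{pmatrix},$$ and for $d\neq 0$ the action $\rho_d$ of $G_d$ on $\mathbb{P}^2$ is given by $$\rho_d(b,t)=\begin{pmatrix} t^{2d}&bt^{d}&b^2/2\\0&t^{d}&b\\0&0&1\end{pmatrix}.$$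 *)

(* Defs.v *)
From HB Require Import structures.
From mathcomp Require Import all_boot all_order all_algebra.
From mathcomp Require Import mpoly.
From mathcomp Require Import ring.

Set Implicit Arguments.
Unset Strict Implicit.
Unset Printing Implicit Defensive.

Import GRing.Theory.
Local Open Scope ring_scope.

(* Varieties over the algebraically closed field K are handled classically,
   through their K-points. *)

Section Group.
Variable K : fieldType.

(* The type G d does not depend on d, but the group structure on it does. *)
Definition G (d : int) : Type := {p : K * K | p.2 != 0}.
HB.instance Definition _ (d : int) := Choice.on (G d).

Variable d : int.
Implicit Types g h : G d.

Definition gb g : K := (val g).1.
Definition gt g : K := (val g).2.

Lemma gt_neq0 g : gt g != 0. Proof. exact: valP g. Qed.

Definition mkG (b t : K) (t_neq0 : t != 0) : G d :=
  exist (fun p : K * K => p.2 != 0) (b, t) t_neq0.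

Lemma eqG g h : gb g = gb h -> gt g = gt h -> g = h.
Proof.
by case: g h => [[b t] ?] [[b' t'] ?]; rewrite /gb /gt /= => eb et;
  apply: val_inj; rewrite /= eb et.
Qed.

Definition Gone : G d := mkG 0 (oner_neq0 K).
Definition Gmul g h : G d :=
  mkG (gb g + gt g ^ d * gb h) (mulf_neq0 (gt_neq0 g) (gt_neq0 h)).
Definition Ginv g : G d :=
  mkG (- (gt g ^ (- d) * gb g)) (invr_neq0 (gt_neq0 g)).

Fact GmulA : associative Gmul.
Proof.
move=> g h k; apply: eqG; last exact: mulrA.
by rewrite /Gmul /gb /gt /= exprzMl ?unitfE ?(valP g) ?(valP h) //; ring.
Qed.

Fact Gmul1 : left_id Gone Gmul.
Proof.
by move=> g; apply: eqG; rewrite /Gmul /gb /gt /= ?exp1rz ?add0r mul1r.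
Qed.

Fact Gmulg1 : right_id Gone Gmul.
Proof.
by move=> g; apply: eqG; rewrite /Gmul /gb /gt /= ?mulr0 ?addr0 ?mulr1.
Qed.

Fact GmulV : left_inverse Gone Ginv Gmul.
Proof.
move=> g; apply: eqG; last exact: mulVf (gt_neq0 g).
by rewrite /Gmul /Ginv /gb /gt /= exprz_inv addNr.
Qed.

Fact GmulgV : right_inverse Gone Ginv Gmul.
Proof.
move=> g; apply: eqG; last exact: mulfV (gt_neq0 g).
rewrite /Gmul /Ginv /gb /gt /= mulrN mulrA -expfzDr ?(valP g) //.
by rewrite subrr expr0z mul1r subrr.
Qed.

HB.instance Definition _ :=
  isGroup.Build (G d) GmulA Gmul1 Gmulg1 GmulV GmulgV.

Definition gcoord g : 'I_2 -> K := tnth [tuple gb g; gt g].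

(* The coordinate ring of G d is K[b, t, t^-1]. *)
Definition regular_fun (f : G d -> K) : Prop :=
  exists (P : {mpoly K[2]}) (n : nat),
    forall g, f g = P.@[gcoord g] / gt g ^+ n.

Definition regular_endoG (alpha : G d -> G d) : Prop :=
  regular_fun (fun g => gb (alpha g)) /\ regular_fun (fun g => gt (alpha g)).

Definition algebraic_autG (alpha : G d -> G d) : Prop :=
  {morph alpha : g h / (g * h)%g} /\
  exists beta : G d -> G d,
    [/\ cancel alpha beta, cancel beta alpha,
        regular_endoG alpha & regular_endoG beta].

End Group.

Section Plane.
Variable K : fieldType.

(* Points of the projective plane are the lines through 0 in K^3. *)
Definition P2 : Type := {L : {vspace 'cV[K]_3} | \dim L == 1}.

Implicit Types (p q : P2) (v w : 'cV[K]_3).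

(* The entries of v are homogeneous coordinates of p. *)
Definition hcoord p v : bool := (v != 0) && (v \in val p).

Definition eval3 (F : {mpoly K[3]}) v : K := F.@[fun i => v i 0].

Definition evalv (F : 'I_3 -> {mpoly K[3]}) v : 'cV[K]_3 :=
  \col_i eval3 (F i) v.

(* The complement of U is the zero locus of a set S of forms. *)
Definition zariski_open (U : P2 -> Prop) : Prop :=
  exists S : {mpoly K[3]} -> Prop,
    (forall F, S F -> exists n : nat, F \is n.-homog) /\
    (forall p, U p <-> exists F v, [/\ S F, hcoord p v & eval3 F v != 0]).

Definition zariski_dense (U : P2 -> Prop) : Prop :=
  forall V, zariski_open V -> (exists p, V p) -> exists p, U p /\ V p.

(* Near each point, j is given by three forms of the same degree.  The
   neighbourhood is the locus where the forms are not all zero: it can be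
   shrunk at will by multiplying the three forms by a common one. *)
Definition regular_endoP2 (j : P2 -> P2) : Prop :=
  forall p, exists (n : nat) (F : 'I_3 -> {mpoly K[3]}),
    [/\ forall i, F i \is n.-homog,
        exists2 v, hcoord p v & evalv F v != 0
      & forall q w, hcoord q w -> evalv F w != 0 -> hcoord (j q) (evalv F w)].

Definition algebraic_autP2 (j : P2 -> P2) : Prop :=
  exists i : P2 -> P2,
    [/\ cancel j i, cancel i j, regular_endoP2 j & regular_endoP2 i].

Definition mx_image (A : 'M[K]_3) (L : {vspace 'cV[K]_3}) :
  {vspace 'cV[K]_3} := (linfun (mulmx A : 'cV[K]_3 -> 'cV[K]_3) @: L)%VS.

Fact mx_image_dim (A : 'M[K]_3) (p : P2) :
  A \in unitmx -> \dim (mx_image A (val p)) == 1.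
Proof.
move=> uA; rewrite /mx_image limg_dim_eq ?(eqP (valP p)) //.
suff -> : lker (linfun (mulmx A : 'cV[K]_3 -> 'cV[K]_3)) = 0%VS.
  by rewrite capv0.
apply/eqP; rewrite -subv0; apply/subvP => v.
rewrite memv_ker memv0 lfunE /= => /eqP Av0.
by rewrite -(mulKmx uA v) Av0 mulmx0.
Qed.

Definition mx_act (A : 'M[K]_3) (uA : A \in unitmx) (p : P2) : P2 :=
  exist (fun L : {vspace 'cV[K]_3} => \dim L == 1)
    (mx_image A (val p)) (mx_image_dim p uA).

End Plane.

Section Actions.
Variables (K : fieldType) (d : int).
Local Notation G := (G K d).
Local Notation P2 := (P2 K).
Implicit Types a : G -> P2 -> P2.

Definition is_left_action a : Prop :=
  (forall p, a 1%g p = p) /\ (forall g h p, a (g * h)%g p = a g (a h p)).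

(* Polynomials in x, y, z whose coefficients are polynomials in b, t. *)
Definition evalGv (F : 'I_3 -> {mpoly {mpoly K[2]}[3]}) (g : G)
    (v : 'cV[K]_3) : 'cV[K]_3 :=
  evalv (fun i => map_mpoly (meval (gcoord g)) (F i)) v.

(* Near each point of G x P2, a is given by three polynomials which are
   homogeneous of the same degree in x, y, z.  Negative powers of t are not
   needed, as the three polynomials can be multiplied by a power of t. *)
Definition regular_action a : Prop :=
  forall g p, exists (n : nat) (F : 'I_3 -> {mpoly {mpoly K[2]}[3]}),
    [/\ forall i, F i \is n.-homog,
        exists2 v, hcoord p v & evalGv F g v != 0
      & forall h q w, hcoord q w -> evalGv F h w != 0 ->
          hcoord (a h q) (evalGv F h w)].

Definition algebraic_action a : Prop := is_left_action a /\ regular_action a.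

(* In characteristic 0 the scheme-theoretic kernel is reduced, so K-points
   suffice. *)
Definition faithful_action a : Prop :=
  forall g, (forall p, a g p = p) -> g = 1%g.

Definition generically_transitive a : Prop :=
  exists U : P2 -> Prop,
    [/\ zariski_open U, zariski_dense U
      & forall p q, U p -> U q -> exists g, a g p = q].

Definition equivalent_actions a1 a2 : Prop :=
  exists (alpha : G -> G) (j : P2 -> P2),
    [/\ algebraic_autG alpha, algebraic_autP2 j
      & forall g p, j (a1 g p) = a2 (alpha g) (j p)].

Definition mx3 (rows : seq (seq K)) : 'M[K]_3 :=
  \matrix_(i, j) (nth [::] rows i)`_j.

Definition tau_mx (k : int) (g : G) : 'M[K]_3 :=
  mx3 [:: [:: gt g ^ k; 0;        0   ];
          [:: 0;        gt g ^ d; gb g];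
          [:: 0;        0;        1   ]].

Definition rho_mx (g : G) : 'M[K]_3 :=
  mx3 [:: [:: gt g ^ (2 * d); gb g * gt g ^ d; gb g ^+ 2 / 2];
          [:: 0;              gt g ^ d;        gb g         ];
          [:: 0;              0;               1            ]].

Fact mx3_upper_unit (x y u v w : K) : x != 0 -> y != 0 ->
  mx3 [:: [:: x; u; v]; [:: 0; y; w]; [:: 0; 0; 1]] \in unitmx.
Proof.
move=> x0 y0; rewrite -unitmx_tr unitmxE det_trig; last first.
  apply/is_trig_mxP => i j; rewrite !mxE.
  by case: i j => [[|[|[|i]]] ?] [[|[|[|j]]] ?].
by rewrite !big_ord_recl big_ord0 !mxE /= !mulr1 unitfE mulf_neq0.
Qed.

Fact tau_unit (k : int) (g : G) : tau_mx k g \in unitmx.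
Proof. by rewrite mx3_upper_unit // expfz_neq0 // gt_neq0. Qed.

Fact rho_unit (g : G) : rho_mx g \in unitmx.
Proof. by rewrite mx3_upper_unit // expfz_neq0 // gt_neq0. Qed.

Definition tau (k : int) (g : G) : P2 -> P2 := mx_act (tau_unit k g).
Definition rho (g : G) : P2 -> P2 := mx_act (rho_unit g).

End Actions.

(* Main.v *)
Require Import Defs.
From mathcomp Require Import all_boot all_order all_algebra.
From mathcomp Require Import separable cyclotomic mpoly ring zify.
From Stdlib Require Import Classical.

Import GRing.Theory.
Local Open Scope ring_scope.

Set Implicit Arguments.
Unset Strict Implicit.
Unset Printing Implicit Defensive.

(** Rings of polynomials over a field are factorial, so the local formulas for
    a : G_d x P^2 -> P^2 are all multiples of one primitive triple F of forms,
    which vanishes nowhere on G_d x (K^3 - 0).  At g = 1 it is proportional to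
    (x, y, z), and a nowhere vanishing form is constant, so F is linear in
    x, y, z: the action is given by invertible matrices depending polynomially
    on (b, t).  Restricted to G_a and to G_m, the projective cocycle is a
    nowhere vanishing polynomial (resp. a monomial), hence trivial, so that
    after normalization U(b) = exp(bN) and T(t) = sum_k t^k T_k are genuine
    representations, with T(t) N = t^d N T(t).  A basis of weight vectors gives
    rho_d if N^2 <> 0 and tau_(d,k) if N^2 = 0.  Generic transitivity forces
    k <> 0 and faithfulness forces gcd(k, d) = 1.

    For uniqueness, the points fixed by G_a = [G_d, G_d] form a single point for
    rho_d and a line for tau_(d,k); the images in G_m of the stabilizers of a
    general point and of a general point of that line are the groups of roots of
    unity of orders |k| and |k - d|, which determine k. *)

(** * Factorial rings *)

(** Being factorial is stated as existence of a factorization into prime elements, which already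
    contains uniqueness; Gauss's lemma becomes a short induction and passes from R to R[X] without a
    fraction field. The forms have coefficients in K[b, t] although t is invertible on the group:
    multiplying by a power of t changes nothing on the plane. Hence all weights of T are natural
    numbers, and the representation differs from the model by a scalar t^m. The torus cocycle is
    only known to be a monomial x^m, which evaluation at 1 cannot remove. Determinants do: det T is
    itself a monomial, and size 3 leaves x^(3m) = 1. For uniqueness with d <> 0, an automorphism of
    G_d induces one of the abstract group G_m, which preserves each equation t^n = 1. This sees only
    |k| and |k - d|; the sign of k is recovered because |k - d| = |k + d| would force k d = 0. For d
    = 0 the sign is really lost, since t -> t^-1 extends to an automorphism of G_0. *)

Definition divides (A : comNzRingType) (x y : A) : Prop := exists z, y = x * z.

Definition prime_elt (A : idomainType) (p : A) : Prop :=
  [/\ p != 0, ~ divides p 1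
    & forall x y, divides p (x * y) -> divides p x \/ divides p y].

Definition factors_into_primes (A : idomainType) (x : A) : Prop :=
  exists (s : seq A) (u : A),
    [/\ {in s, forall p, prime_elt p}, divides u 1 & x = u * \prod_(p <- s) p].

Definition factorial (A : idomainType) : Prop :=
  forall x : A, x != 0 -> factors_into_primes x.

Section Divides.
Variable A : idomainType.
Implicit Types (x y p q : A) (s : seq A).

Lemma divides_mulr x y z : divides x y -> divides x (y * z).
Proof. by case=> w ->; exists (w * z); rewrite mulrA. Qed.

Lemma divides_mull x y z : divides x y -> divides x (z * y).
Proof. by move/(divides_mulr z); rewrite mulrC. Qed.

Lemma divides_trans x y z : divides x y -> divides y z -> divides x z.
Proof. by move=> dxy [w ->]; apply: divides_mulr. Qed.

Lemma dividesD x y z : divides x y -> divides x z -> divides x (y + z).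
Proof. by case=> a -> [b ->]; exists (a + b); rewrite mulrDr. Qed.

Lemma dividesN x y : divides x y -> divides x (- y).
Proof. by case=> a ->; exists (- a); rewrite mulrN. Qed.

Lemma divides_mul2l z x y : z != 0 -> divides (z * x) (z * y) -> divides x y.
Proof.
by move=> z0 [w]; rewrite -mulrA => /(mulfI z0) ->; exists w.
Qed.

(** Each prime [p] of the list fails to divide some [F i], so it must divide [q]; it cancels on both
    sides and the rest of the list is treated in the same way. *)
Lemma primitive_gauss (I : Type) (F : I -> A) s q :
    {in s, forall p, prime_elt p} ->
    {in s, forall p, exists i, ~ divides p (F i)} ->
    (forall i, divides (\prod_(p <- s) p) (q * F i)) ->
  divides (\prod_(p <- s) p) q.
Proof.
elim: s q => [|p s IHs] q pr_s prim dvdq.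
  by exists q; rewrite big_nil mul1r.
have /[!big_cons] dvd_pq := dvdq.
have [p0 _ pP] := pr_s p (mem_head _ _).
have [i ndvd] := prim p (mem_head _ _).
have [[r Dq]|//] : divides p q \/ divides p (F i).
  by apply: pP; case: (dvd_pq i) => w ->; exists ((\prod_(j <- s) j) * w);
    rewrite mulrA.
rewrite Dq; suff [w ->] : divides (\prod_(p <- s) p) r.
  by exists w; rewrite mulrA.
apply: IHs => [x xs|x xs|j].
- by apply: pr_s; rewrite inE xs orbT.
- by apply: prim; rewrite inE xs orbT.
by apply: (divides_mul2l p0); rewrite mulrA -Dq.
Qed.

Lemma prime_not_divides_unit p u : prime_elt p -> divides u 1 -> ~ divides p u.
Proof. by case=> _ npu _ u1 pu; apply: npu; apply: divides_trans u1. Qed.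

Lemma prime_divides_prod p s : prime_elt p ->
  divides p (\prod_(x <- s) x) -> exists2 x, x \in s & divides p x.
Proof.
move=> prp; have [_ np1 pP] := prp; elim: s => [|x s IHs]; rewrite ?big_nil //.
rewrite big_cons => /pP [px|/IHs [y ys py]]; first by exists x; rewrite ?mem_head.
by exists y; rewrite // inE ys orbT.
Qed.

Lemma prime_dividesC p q : prime_elt p -> prime_elt q ->
  divides p q -> divides q p.
Proof.
move=> [p0 np1 _] [q0 _ qP] [w Dq].
have [//|[y Dw]] : divides q p \/ divides q w.
  by apply: qP; rewrite -Dq; exists 1; rewrite mulr1.
case: np1; exists y; apply/eqP; rewrite eq_sym -(inj_eq (mulfI q0)) mulr1.
by rewrite {2}Dq {1}Dw; apply/eqP; ring.
Qed.

Lemma factors_into_primesM x y :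
  factors_into_primes x -> factors_into_primes y -> factors_into_primes (x * y).
Proof.
move=> [s [u [pr_s [u' u1] ->]]] [t [v [pr_t [v' v1] ->]]].
exists (s ++ t), (u * v); split.
- by move=> p; rewrite mem_cat => /orP [/pr_s|/pr_t].
- by exists (u' * v'); rewrite mulrACA -u1 -v1 mulr1.
by rewrite big_cat /=; ring.
Qed.

Lemma factorial_gauss (fA : factorial A) (I : Type) (F : I -> A) x q :
    x != 0 ->
    (forall p, prime_elt p -> divides p x -> exists i, ~ divides p (F i)) ->
    (forall i, divides x (q * F i)) ->
  divides x q.
Proof.
move=> x0 prim dvdx; have [s [u [pr_s [v uv] Dx]]] := fA x x0.
have Ds : \prod_(p <- s) p = v * x by rewrite Dx mulrA [v * u]mulrC -uv mul1r.
have [w Dq] : divides (\prod_(p <- s) p) q.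
  apply: (@primitive_gauss I F) => // [p ps|i].
    apply: prim; first exact: pr_s.
    by rewrite Dx (big_rem p) //=; apply: divides_mull; exists (\prod_(y <- rem p s) y).
  case: (dvdx i) => w ->; exists (u * w); rewrite Ds.
  by rewrite mulrACA [v * u]mulrC -uv mul1r.
by exists (v * w); rewrite Dq Ds; ring.
Qed.

(** Extraction of the content of a finite family. A prime dividing all [F i] is associate to a prime
    in a factorization of [F i0], so dividing it out shortens that factorization and the process
    stops. *)
Lemma primitive_part (fA : factorial A) (I : finType) (F : I -> A) i0 :
    F i0 != 0 ->
  exists (c : A) (H : I -> A), [/\ c != 0, forall i, F i = c * H i
    & forall p, prime_elt p -> exists i, ~ divides p (H i)].
Proof.
move=> F0; have [s [u [pr_s u1 DF]]] := fA _ F0.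
have [n] := ubnP (size s); elim: n s F F0 pr_s DF => // n IHn s F F0 pr_s DF szs.
case: (classic (exists2 p, prime_elt p & forall i, divides p (F i))); last first.
  move=> noprime; exists 1, F; rewrite oner_neq0; split=> // [i|p prp].
    by rewrite mul1r.
  by apply: not_all_ex_not => dvdF; apply: noprime; exists p.
move=> [p prp dvdF]; have [p0 _ pP] := prp.
have [H DH] : exists H : I -> A, forall i, F i = p * H i.
  by apply: (fin_all_exists (P := fun i h => F i = p * h)) => i; case: (dvdF i) => w ->; exists w.
have [q qs pq] : exists2 q, q \in s & divides p q.
  apply: prime_divides_prod => //.
  by have := dvdF i0; rewrite DF => /pP [/(prime_not_divides_unit prp u1)|].
have [w Dp] : divides q p by apply: prime_dividesC pq => //; apply: pr_s.
case: pq => v Dq; have q0 : q != 0 by case: (pr_s q qs).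
have vw : w * v = 1.
  by apply: (mulfI q0); rewrite mulr1 mulrA -Dp -Dq.
(* p and q are associates, so the family may be divided by q instead of p *)
have DF' i : F i = q * (w * H i) by rewrite mulrA -Dp.
have [|x xs|||c [H' [c0 DH' prim]]] := IHn (rem q s) (fun i => w * H i).
- by move: F0; rewrite DF' mulf_eq0 => /norP[].
- by apply: pr_s; apply: mem_rem xs.
- by apply: (mulfI q0); rewrite -DF' DF (big_rem q) //=; ring.
- by rewrite size_rem // -ltnS (leq_trans _ szs) // prednK //; case: (s) qs.
exists (q * c), H'; rewrite mulf_neq0 //; split=> // i.
by rewrite DF' DH' mulrA.
Qed.

End Divides.

Lemma ex_minimal (P : nat -> Prop) : (exists n, P n) ->
  exists2 n, P n & forall m, P m -> (n <= m)%N.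
Proof.
move=> [n]; elim/ltn_ind: n => n IHn Pn.
have [[m mn Pm]|nosmaller] := classic (exists2 m, (m < n)%N & P m).
  exact: IHn Pm.
exists n => // m Pm; rewrite leqNgt; apply/negP => mn.
by apply: nosmaller; exists m.
Qed.

(** * Polynomials in one variable over a factorial ring *)

Section FactorialPoly.
Variable R : idomainType.
Implicit Types (p q f g h : {poly R}) (a b c x y : R).

Lemma divides_polyC a b : divides a%:P b%:P -> divides a b.
Proof. by case=> q /(congr1 (coefp 0)); rewrite /= coefCM !coefC /=; exists q`_0. Qed.

Lemma prime_elt_polyC a : prime_elt a -> prime_elt a%:P.
Proof.
case=> a0 na1 aP; split; first by rewrite polyC_eq0.
  by rewrite -polyC1 => /divides_polyC.
have divX f : divides a%:P (f * 'X) -> divides a%:P f.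
  case=> q Dq.
  have /factor_theorem [r Dr] : root q 0.
    have /eqP := congr1 (horner^~ 0) Dq.
    by rewrite !hornerE eq_sym mulf_eq0 (negPf a0).
  move: Dq; rewrite Dr subr0 mulrA => /(mulIf (negbT (polyX_eq0 _))) ->.
  by exists r.
move=> f g; have [n] := ubnP (size f + size g); elim: n f g => // n IHn f g.
have [-> _ _|f0] := eqVneq f 0; first by left; exists 0; rewrite mulr0.
have [-> _ _|g0] := eqVneq g 0; first by right; exists 0; rewrite mulr0.
have split_const h : exists h', h = h' * 'X + (h`_0)%:P /\
    (h != 0 -> (size h' < size h)%N).
  elim/poly_ind: h => [|h c _]; first by exists 0; rewrite mul0r coef0 addr0 eqxx.
  exists h; rewrite coefD coefMX coefC eqxx add0r; split=> // hX0.
  rewrite -cons_poly_def size_cons_poly; case: ifP => // /andP[h0 /eqP c0].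
  by move: hX0 h0; rewrite /nilp size_poly_eq0 c0 addr0 => /[swap] /eqP ->; rewrite mul0r eqxx.
have [f' [Df /(_ f0) szf]] := split_const f.
have [g' [Dg /(_ g0) szg]] := split_const g.
rewrite ltnS => szfg dvd_fg.
have [dvd_f|dvd_g] : divides a f`_0 \/ divides a g`_0.
  apply: aP; rewrite -coef0M; case: dvd_fg => q ->.
  by rewrite coefCM; exists q`_0.
  have [c Dc] := dvd_f.
  have dvd_c : divides a%:P (f`_0)%:P by exists c%:P; rewrite Dc polyCM.
  have [||/(divides_mulr 'X) dvd_f'|] := IHn f' g; last by right.
  - by apply: leq_trans szfg; rewrite ltn_add2r.
  - apply: divX; rewrite mulrAC (_ : f' * 'X = f - (f`_0)%:P); last by rewrite {1}Df addrK.
    by rewrite mulrBl; apply: dividesD => //; apply/dividesN/divides_mulr.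
  by left; rewrite Df; apply: dividesD.
have [c Dc] := dvd_g.
have dvd_c : divides a%:P (g`_0)%:P by exists c%:P; rewrite Dc polyCM.
have [|||/(divides_mulr 'X) dvd_g'] := IHn f g'; last 1 first.
- by right; rewrite Dg; apply: dividesD.
- by apply: leq_trans szfg; rewrite ltn_add2l.
- apply: divX; rewrite -mulrA (_ : g' * 'X = g - (g`_0)%:P); last by rewrite {1}Dg addrK.
  by rewrite mulrBr; apply: dividesD => //; apply/dividesN/divides_mull.
by left.
Qed.

Definition primitive_poly f := forall a, prime_elt a -> ~ divides a%:P f.

Hypothesis fR : factorial R.

Lemma primitive_poly_gauss c q f :
  c != 0 -> primitive_poly f -> divides c%:P (q * f) -> divides c%:P q.
Proof.
move=> c0 primf; have [s [u [pr_s [v uv] ->]]] := fR c0.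
rewrite polyCM rmorph_prod => -[w Dw].
have uvP : 1 = u%:P * v%:P :> {poly R} by rewrite -polyCM -uv.
have [|_ /mapP[a sa ->]|_|r Dr] := @primitive_gauss _ unit (fun=> f) (map polyC s) q.
- by move=> _ /mapP[a /pr_s /prime_elt_polyC ? ->].
- by exists tt; apply: primf; apply: pr_s.
- by rewrite big_map; exists (u%:P * w); rewrite Dw; ring.
by exists (v%:P * r); rewrite Dr big_map -[LHS]mul1r uvP; ring.
Qed.

Lemma primitive_poly_part f : f != 0 ->
  exists c g, [/\ c != 0, f = c%:P * g & primitive_poly g].
Proof.
move=> f0; have szf : (0 < size f)%N by rewrite size_poly_gt0.
have szE : size f = (size f).-1.+1 by rewrite prednK.
have [|c [H [c0 DH primH]]] :=
    @primitive_part R fR _ (fun i : 'I_(size f).-1.+1 => f`_i) ord_max.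
  by rewrite lead_coef_eq0.
exists c, (\poly_(i < size f) H (inord i)); split=> // [|a pra [q Dq]].
  apply/polyP => i; rewrite coefCM coef_poly; case: ltnP => [ltif|]; last first.
    by move/(nth_default 0) ->; rewrite mulr0.
  by rewrite -DH inordK // prednK.
have [i ndvd] := primH a pra; apply: ndvd; exists q`_i.
have ltif : (i < size f)%N by case: (i) => j /=; rewrite -szE.
by rewrite -coefCM -Dq coef_poly ltif inord_val.
Qed.

(** The usual argument uses the Euclidean ring over the fraction field. Here pseudo-division
    replaces division, and the constants it introduces are removed by Gauss's lemma. *)
Lemma indecomposable_prime f : f != 0 -> primitive_poly f ->
    (forall g h, f = g * h -> (size g < size f)%N -> (size h < size f)%N -> False) ->
    (1 < size f)%N -> prime_elt f.
Proof.
move=> f0 primf indec szf.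
split=> // [[g /(congr1 (size : {poly R} -> nat))]|g h dvd_gh].
  have [->|g0] := eqVneq g 0; first by rewrite mulr0 size_poly0 size_poly1.
  rewrite size_mul // size_poly1 => /eqP; rewrite eqn_leq => /andP[_].
  rewrite -size_poly_gt0 in g0; have := leq_add szf g0.
  by case: (size f + size g)%N => [|[|[|k]]].
have [->|g0] := eqVneq g 0; first by left; exists 0; rewrite mulr0.
(* [inI] is the ideal of [f] and [g]; a nonzero element [m] of least size plays the part of their
   gcd over the fraction field. *)
pose inI (x : {poly R}) := exists u v, x = u * f + v * g.
have [_ [m [[u [v Dm]] m0 <-]] min_m] :
    exists2 n, (exists m, [/\ inI m, m != 0 & size m = n])
             & forall k, (exists m, [/\ inI m, m != 0 & size m = k]) -> (n <= k)%N.
  apply: ex_minimal; exists (size f), f; split=> //.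
  by exists 1, 0; rewrite mul1r mul0r addr0.
have pdivI (x : {poly R}) : inI x -> exists2 c : R, c != 0 & divides m (c%:P * x).
  move=> [u' [v' Dx]]; exists (lead_coef m ^+ scalp x m).
    by rewrite expf_neq0 // lead_coef_eq0.
  have Ddiv := Pdiv.Idomain.divp_eq x m; have szr := ltn_modpN0 x m0.
  set r := x %% m in Ddiv szr.
  have [r0|r0] := eqVneq r 0.
    by exists (x %/ m); rewrite mul_polyC Ddiv r0 addr0 mulrC.
  suff /min_m : exists m', [/\ inI m', m' != 0 & size m' = size r].
    by rewrite leqNgt szr.
  exists r; split=> //; set l := _ ^+ _ in Ddiv.
  exists (l%:P * u' - x %/ m * u), (l%:P * v' - x %/ m * v).
  apply/esym/eqP; rewrite -subr_eq0 -[r](addKr (x %/ m * m)) -Ddiv -mul_polyC Dx Dm.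
  by apply/eqP; ring.
have [c [m1 [c0 Dm1 primm1]]] := primitive_poly_part m0.
have m1I (x : {poly R}) : inI x -> divides m1 x.
  case/pdivI => l l0 [q]; rewrite Dm1 => Dq.
  have [|w Dw] := @primitive_poly_gauss l (q * c%:P) m1 l0 primm1.
    by exists x; rewrite Dq; ring.
  exists w; apply: (@mulfI _ l%:P); first by rewrite polyC_eq0.
  by rewrite Dq mulrCA -Dw; ring.
have [w Df] : divides m1 f by apply: m1I; exists 1, 0; rewrite mul1r mul0r addr0.
have [s Dg] : divides m1 g by apply: m1I; exists 0, 1; rewrite mul1r mul0r add0r.
have w0 : w != 0 by apply: contraNneq f0 => w0; rewrite Df w0 mulr0.
have m10 : m1 != 0 by apply: contraNneq f0 => m10; rewrite Df m10 mul0r.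
have szm : size m = size m1 by rewrite Dm1 size_Cmul.
(* If [m] is constant, then [m * h] is a multiple of [f], and primitivity of [f] removes the
   constant. Otherwise the cofactor [w] of [m1] in [f] is a constant, even a unit, so [f] divides
   [g]. *)
have [szm1|szm1] := leqP (size m1) 1.
  right; have /size_poly1P [m' m'0 Dm'] : size m == 1.
    by rewrite szm eqn_leq szm1 size_poly_gt0.
  have [z Dz] := dvd_gh.
  have [|y Dy] := @primitive_poly_gauss m' (u * h + v * z) f m'0 primf.
    by exists h; rewrite -Dm' Dm mulrDl mulrDl -[v * g * h]mulrA Dz; ring.
  exists y; apply: (@mulfI _ m'%:P); first by rewrite polyC_eq0.
  rewrite mulrCA -Dy -Dm' Dm mulrDl mulrDr.
  by rewrite -[v * g * h]mulrA Dz; ring.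
left; have szw : (size w <= 1)%N.
  rewrite leqNgt; apply/negP => szw; apply: (indec _ _ Df).
    by rewrite Df size_mul // -subn1 ltn_subRL addnC ltn_add2l.
  by rewrite Df size_mul // -subn1 ltn_subRL ltn_add2r.
have /size_poly1P [e e0 De] : size w == 1 by rewrite eqn_leq szw size_poly_gt0.
have [t [e' [pr_t [e'' ee''] De']]] := fR e0.
(* A prime factor of the constant cofactor would divide the primitive [f]. *)
suff t0 : t = [::].
  exists (e''%:P * s); rewrite Dg Df De De' t0 big_nil mulr1.
  by rewrite mulrA -[m1 * _ * _]mulrA -polyCM -ee'' mulr1.
case: t pr_t De' => // a t pr_t De'; case: (primf a); first exact/pr_t/mem_head.
by exists ((e' * \prod_(p <- t) p)%:P * m1); rewrite Df De De' big_cons !polyCM; ring.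
Qed.

(** The content is factored in [R]; the primitive part either splits into factors of smaller size or
    is prime by [indecomposable_prime]. *)
Lemma factorial_poly : factorial {poly R}.
Proof.
move=> f; have [n] := ubnP (size f); elim: n f => // n IHn f szf f0.
have factC c : c != 0 -> factors_into_primes c%:P.
  move=> c0; have [s [u [pr_s [v uv] ->]]] := fR c0.
  exists (map polyC s), u%:P; split.
  - by move=> _ /mapP[a /pr_s /prime_elt_polyC ? ->].
  - by exists v%:P; rewrite -polyCM -uv.
  by rewrite polyCM rmorph_prod big_map.
have [szf1|szf1] := leqP (size f) 1.
  by rewrite (size1_polyC szf1) in f0 *; apply: factC; rewrite polyC_eq0 in f0.
have [c [g [c0 Df primg]]] := primitive_poly_part f0.
have szfg : size f = size g by rewrite Df size_Cmul.
have g0 : g != 0 by rewrite -size_poly_gt0 -szfg size_poly_gt0.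
rewrite Df; apply: factors_into_primesM; first exact: factC.
have [[g1 [g2 [Dg sz1 sz2]]]|indec] :=
  classic (exists g1 g2, [/\ g = g1 * g2, (size g1 < size g)%N & (size g2 < size g)%N]).
  have [g10 g20] : g1 != 0 /\ g2 != 0.
    by move: g0; rewrite Dg mulf_eq0 => /norP[].
  rewrite Dg; apply: factors_into_primesM; apply: IHn => //.
    by rewrite -ltnS (leq_trans _ szf) // ltnS szfg.
  by rewrite -ltnS (leq_trans _ szf) // ltnS szfg.
exists [:: g], 1; rewrite big_seq1 mul1r; split=> // [_ /[!inE] /eqP->|].
  apply: indecomposable_prime; rewrite -?szfg // => g1 g2 Dg sz1 sz2.
  by apply: indec; exists g1, g2; rewrite -szfg.
by exists 1; rewrite mulr1.
Qed.

End FactorialPoly.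

(** * Polynomials in several variables *)

Section FactorialMPoly.

Lemma factorial_iso (A B : idomainType) (f : A -> B) (g : B -> A) :
    {morph f : x y / x * y} -> f 0 = 0 -> cancel f g -> cancel g f ->
  factorial B -> factorial A.
Proof.
move=> fM f0 fK gK fB x x0.
have f_inj := can_inj fK.
have gM : {morph g : y z / y * z}.
  by move=> y z; rewrite -{1}[y]gK -{1}[z]gK -fM fK.
have f1 : f 1 = 1 by rewrite -[LHS]mulr1 -[X in _ * X]gK -fM mul1r gK.
have g1 : g 1 = 1 by rewrite -f1 fK.
have divf y z : divides (f y) z -> divides y (g z).
  by case=> w ->; exists (g w); rewrite gM fK.
have divg y z : divides y z -> divides (f y) (f z).
  by case=> w ->; exists (f w); rewrite fM.
have [|s [u [pr_s [v uv] Dx]]] := fB (f x).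
  by rewrite -f0 (inj_eq f_inj).
exists (map g s), (g u); split.
- move=> _ /mapP[p /pr_s [p0 np1 pP] ->]; split.
  + by rewrite -(inj_eq f_inj) gK f0.
  + by move/divg; rewrite gK f1.
  move=> y z /divg; rewrite gK fM => /pP.
  by rewrite -{1 2}[p]gK => -[/divf|/divf]; rewrite fK; [left|right].
- by exists (g v); rewrite -gM -uv g1.
rewrite -[x]fK Dx gM; congr (_ * _).
by elim: (s) => [|p t IHt] /=; rewrite ?big_nil ?g1 // !big_cons gM IHt.
Qed.

Lemma factorial_field (F : fieldType) : factorial F.
Proof.
move=> x x0; exists [::], x; rewrite big_nil mulr1; split=> //.
by exists x^-1; rewrite mulfV.
Qed.

(** The inverse widens the coefficients and substitutes the last variable for X. This makes
    induction on the number of variables available. *)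
Lemma muni_bij (n : nat) (R : idomainType) : bijective (@muni n R).
Proof.
pose mm : {poly {mpoly R[n]}} -> {mpoly R[n.+1]} :=
  fun p => (mpwiden p).['X_ord_max].
have mmC c : mm c%:P = mwiden c by rewrite /mm mpwidenC hornerC.
have mmX : mm 'X = 'X_ord_max by rewrite /mm mpwidenX hornerX.
have mmD : {morph mm : p q / p + q}.
  by move=> p q; rewrite /mm raddfD hornerD.
have mmM : {morph mm : p q / p * q}.
  by move=> p q; rewrite /mm rmorphM hornerM.
have mmXn k : mm 'X^k = 'X_ord_max ^+ k.
  by elim: k => [|k IHk]; rewrite ?mmC ?mwiden1 // !exprS mmM mmX IHk.
have munimX i : muni (mwiden 'X_i : {mpoly R[n.+1]}) = ('X_i)%:P.
  rewrite mwidenX muniE msuppX big_seq1 mcoeffX eqxx scale1r -mul_polyC.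
  rewrite mnmwiden_ordmax expr0 mulr1; congr ('X_[_])%:P.
  by apply/mnmP => j; rewrite mnmE mnmwiden_widen.
have munimw (p : {mpoly R[n]}) : muni (mwiden p) = p%:P.
  elim/mpolyind: p => [|c m p _ _ IHp]; first by rewrite mwidenC muniC.
  rewrite mwidenD muniD [X in _ + X]IHp polyCD; congr (_ + _).
  rewrite mwidenZ muniZ mwidenX muniE msuppX big_seq1 mcoeffX eqxx scale1r.
  rewrite mnmwiden_ordmax expr0 -mul_mpolyC -mul_polyC polyCM alg_polyC; congr (_ * ('X_[_])%:P).
  by apply/mnmP => j; rewrite mnmE mnmwiden_widen.
exists mm => p.
  elim/mpolyind: p => [|c m p _ _ IHp].
    by rewrite muni0 mmC mwidenC.
  rewrite muniD mmD.
  transitivity (c *: 'X_[m] + mm (muni p)); last by rewrite IHp.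
  congr (_ + _).
  rewrite muniZ muniE msuppX big_seq1 mcoeffX eqxx scale1r -!mul_polyC.
  rewrite !mmM !mmC mmXn mwidenC mwidenX -mul_mpolyC; congr (_ * _).
  rewrite mpolyXn -mpolyXD; congr 'X_[_]; apply/mnmP => i.
  rewrite mnmDE mulmnE mnm1E.
  have [<-|ni] := eqVneq ord_max i.
    by rewrite mnmwiden_ordmax mul1n.
  have ltin : (i < n)%N.
    by rewrite ltn_neqAle -ltnS ltn_ord andbT; apply: contraNneq ni => ni; apply/eqP/val_inj.
  rewrite mul0n addn0; have -> : i = widen_ord (leqnSn n) (Ordinal ltin) by apply: val_inj.
  by rewrite mnmwiden_widen mnmE.
elim/poly_ind: p => [|p c IHp]; first by rewrite mmC mwidenC muniC.
rewrite mmD mmM mmX mmC muniD muniM munimw [muni (mm p)]IHp; congr (_ * _ + _).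
rewrite muniE msuppX big_seq1 mcoeffX eqxx scale1r mnm1E eqxx expr1.
rewrite (_ : [multinom _ | _ < _] = 0%MM) ?mpolyX0 ?scale1r //.
apply/mnmP => j; rewrite mnmE mnm1E mnm0E; case: eqP => // /(congr1 val) /= jn.
by have := ltn_ord j; rewrite -jn ltnn.
Qed.

Lemma factorial_mpoly (n : nat) (R : idomainType) :
  factorial R -> factorial {mpoly R[n]}.
Proof.
move=> fR; elim: n => [|n IHn].
  apply: (@factorial_iso {mpoly R[0]} R (mcoeff 0%MM) (@mpolyC 0 R)) fR => [p q||x|x].
  - exact: rmorphM.
  - exact: mcoeff0.
  - by apply/mpolyP => m; rewrite mcoeffC (_ : m = 0%MM) ?eqxx ?mulr1 //; apply/mnmP; case.
  exact: mpolyCK.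
have [mm muniK mmK] := muni_bij n R.
apply: (@factorial_iso {mpoly R[n.+1]} {poly {mpoly R[n]}} (@muni n R) mm) (factorial_poly IHn) => [p q||//|//].
- exact: muniM.
- exact: muni0.
Qed.

End FactorialMPoly.

(** * Polynomials that vanish at all points *)

Section EvaluationVanishes.
Variable K : closedFieldType.

Lemma meval_muni n (p : {mpoly K[n.+1]}) (v : 'I_n.+1 -> K) :
  p.@[v] = (map_poly (meval (fun i => v (widen_ord (leqnSn n) i))) (muni p)).[v ord_max].
Proof.
elim/mpolyind: p => [|c m p _ _ IHp]; first by rewrite meval0 muni0 rmorph0 horner0.
rewrite mevalD.
rewrite IHp.
rewrite muniD.
rewrite rmorphD.
rewrite hornerD.
congr (_ + _).
rewrite mevalZ mevalX muniZ muniE msuppX big_seq1 mcoeffX eqxx scale1r.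
rewrite -!mul_polyC.
rewrite !rmorphM /=.
rewrite !map_polyC /=.
rewrite map_polyXn !hornerM !hornerC hornerXn.
rewrite mevalC mevalX big_ord_recr /=; congr (_ * (_ * _)).
by apply: eq_bigr => i _; rewrite mnmE.
Qed.

(** With the first variables fixed, a nonzero polynomial in the last one would have a non-root; so
    each of its coefficients vanishes at all points, and induction applies to them. *)
Lemma meval_all_eq0 n (p : {mpoly K[n]}) : (forall v, p.@[v] = 0) -> p = 0.
Proof.
elim: n p => [|n IHn] p p0.
  apply/mpolyP => m; have /= := p0 (fun=> 0).
  rewrite mcoeff0; case: m => -[m sm]; rewrite {}[p](_ : p = (p@_0%MM)%:MP).
    rewrite mevalC => ->; rewrite mcoeffC mul0r //.
  apply/mpolyP => m'; rewrite mcoeffC (_ : m' = 0%MM) ?eqxx ?mulr1 //.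
  by apply/mnmP; case.
have [mm muniK _] := muni_bij n K.
apply: (can_inj muniK); rewrite muni0; apply/polyP => i; rewrite coef0.
apply: IHn => v.
have /polyP/(_ i) : map_poly (meval v) (muni p) = 0.
  apply/eqP/negPn/negP => /closed_nonrootP [x]; rewrite /root => /negP; apply.
  pose w (j : 'I_n.+1) := if unlift ord_max j is Some k then v k else x.
  have := p0 w; rewrite meval_muni {2}/w unlift_none => <-.
  apply/eqP; congr (_.[_]); apply: eq_map_poly => q; apply: meval_eq => k.
  have -> : widen_ord (leqnSn n) k = lift ord_max k.
    by apply: val_inj; rewrite /= /bump leqNgt ltn_ord.
  by rewrite /w liftK.
by rewrite coef_map coef0.
Qed.

End EvaluationVanishes.

(** Since X is prime in A[X], the powers of X on the right are distributed one by one between the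
    two factors. *)
Lemma monomial_factor (A : idomainType) (f g : {poly A}) c k : c != 0 -> f * g = c%:P * 'X^k ->
  exists a l, f = a%:P * 'X^l.
Proof.
elim: k f g => [|k IHk] f g c0 Dfg.
  have : f * g != 0 by rewrite Dfg expr0 mulr1 polyC_eq0.
  rewrite mulf_eq0 negb_or => /andP[f0 g0].
  exists f`_0, 0; rewrite expr0 mulr1; apply: size1_polyC.
  have /eqP := congr1 (size : {poly A} -> nat) Dfg.
  rewrite expr0 mulr1 size_polyC c0 size_mul // eqn_leq => /andP[+ _].
  rewrite -!size_poly_gt0 in f0 g0 *.
  case: (size f) f0 => // [[|s]] // _; case: (size g) g0 => // t _.
  by rewrite addnS /= addSn.
have divX (h : {poly A}) : h`_0 = 0 -> exists h', h = h' * 'X.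
  move=> h0; have /factor_theorem [h' ->] : root h 0 by rewrite /root horner_coef0 h0.
  by exists h'; rewrite subr0.
have /eqP := congr1 (fun p : {poly A} => p`_0) Dfg.
rewrite exprS mulrCA !coef0M coefX mul0r mulf_eq0.
have X0 : 'X != 0 :> {poly A} by rewrite polyX_eq0.
case/orP => /eqP/divX [h Dh].
  have [|a [l Dl]] := IHk h g c0; last by exists a, l.+1; rewrite Dh Dl exprSr mulrA.
  by apply: (mulIf X0); rewrite mulrAC -Dh Dfg exprSr mulrA.
have [|a [l Dl]] := IHk f h c0; last by exists a, l.
by apply: (mulIf X0); rewrite -mulrA -Dh Dfg exprSr mulrA.
Qed.

(** * Factors of homogeneous polynomials *)

Section HomogeneousFactors.
Variables (A : idomainType) (n : nat).
Implicit Types (p q : {mpoly A[n]}).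

(** The substitution of x_i T for x_i. The component of degree d becomes the coefficient of T^d, so
    a homogeneous polynomial becomes a monomial in T. *)
Definition graded : {mpoly A[n]} -> {poly {mpoly A[n]}} :=
  mmap (polyC \o @mpolyC n A) (fun i => ('X_i)%:P * 'X).

Lemma gradedM : {morph graded : p q / p * q}.
Proof. exact: rmorphM. Qed.

Lemma coef_graded p d : (graded p)`_d = pihomog mdeg d p.
Proof.
rewrite /graded /mmap coef_sum pihomogE [RHS]big_mkcond; apply: eq_bigr => m _ /=.
have -> : mmap1 (fun i => ('X_i)%:P * 'X) m = ('X_[m])%:P * 'X^(mdeg m) :> {poly {mpoly A[n]}}.
  rewrite mpolyXE_id rmorph_prod /= mdegE /mmap1.
  rewrite (eq_bigr (fun i => ('X_i ^+ m i)%:P * 'X^(m i))) => [|i _]; last first.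
    by rewrite exprMn rmorphXn.
  by rewrite big_split /= prodrXr.
rewrite coefCM coefCM coefXn eq_sym mul_mpolyC.
by case: ifP; rewrite ?mulr1 // mulr0 scaler0.
Qed.

Lemma graded_homog p d : p \is d.-homog -> graded p = p%:P * 'X^d.
Proof.
move=> homp; apply/polyP => i; rewrite coef_graded coefCM coefXn.
have [->|id] := eqVneq i d; first by rewrite pihomog_dE // mulr1.
by rewrite mulr0 (@pihomog_ne0 _ _ _ d) // eq_sym.
Qed.

Lemma homog_factor p q d : p * q != 0 -> p * q \is d.-homog ->
  exists k, p \is k.-homog.
Proof.
move=> pq0 /graded_homog; rewrite gradedM => /(monomial_factor pq0) [a [k Dp]].
exists k; rewrite (@pihomog_partitionE _ _ mdeg (msize p) p) //.
apply: rpred_sum => i _; have [<-|ik] := eqVneq (i : nat) k; first exact: pihomogP.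
by rewrite -coef_graded Dp coefCM coefXn (negPf ik) mulr0 rpred0.
Qed.

Lemma homog_factors p q d : p * q != 0 -> p * q \is d.-homog ->
  exists k l, [/\ p \is k.-homog, q \is l.-homog & d = (k + l)%N].
Proof.
move=> pq0 hompq; have [k homp] := homog_factor pq0 hompq.
have [l homq] : exists l, q \is l.-homog.
  by rewrite mulrC in pq0 hompq; apply: homog_factor hompq.
by exists k, l; split=> //; apply: (dhomog_uniq pq0 hompq (dhomogM homp homq)).
Qed.

End HomogeneousFactors.

Section Proportional.
Variable A : idomainType.

(** The vanishing of the 2 x 2 minors expresses proportionality without division and allows zero
    families. *)
Definition proportional (I : Type) (F H : I -> A) := forall i j, F i * H j = F j * H i.

(** [H i0] divides [F i0 * H i] for every [i]; as [H] is primitive, Gauss's lemma makes it divide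
    [F i0], and the quotient is the factor sought. *)
Lemma proportional_primitive (fA : factorial A) (I : Type) (F H : I -> A) i0 :
    H i0 != 0 -> (forall p, prime_elt p -> exists i, ~ divides p (H i)) ->
  proportional F H -> exists h, forall i, F i = h * H i.
Proof.
move=> H0 primH propFH.
have [h Dh] : divides (H i0) (F i0).
  apply: (@factorial_gauss _ fA I H) => // [p prp _|i]; first exact: primH.
  by exists (F i); rewrite propFH mulrC.
exists h => i; apply: (mulIf H0).
by rewrite propFH Dh; ring.
Qed.

End Proportional.

(** * Global forms of an action *)

Section ProjectivePoints.
Variable K : fieldType.
Implicit Types (p q : P2 K) (v w : 'cV[K]_3).

Lemma hcoord_ex p : exists v, hcoord p v.
Proof.
exists (vpick (val p)); rewrite /hcoord memv_pick andbT vpick0.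
by have := valP p; rewrite -dimv_eq0 => /eqP ->.
Qed.

Lemma hcoord_line p v : hcoord p v -> val p = <[v]>%VS.
Proof.
case/andP => v0 vp; apply/esym/eqP; rewrite eqEdim -memvE vp dim_vline v0.
by rewrite (eqP (valP p)).
Qed.

Lemma hcoord_inj p q v : hcoord p v -> hcoord q v -> p = q.
Proof. by move=> /hcoord_line pv /hcoord_line qv; apply: val_inj; rewrite /= pv qv. Qed.

Lemma hcoord_scale p v w : hcoord p v -> hcoord p w ->
  exists2 c, c != 0 & w = c *: v.
Proof.
move=> /hcoord_line pv /andP[w0]; rewrite pv => /vlineP [c Dw]; exists c => //.
by apply: contraNneq w0 => c0; rewrite Dw c0 scale0r.
Qed.

Lemma hcoordZ p v c : c != 0 -> hcoord p (c *: v) = hcoord p v.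
Proof. by move=> c0; rewrite /hcoord scaler_eq0 (negPf c0) rpredZeq (negPf c0). Qed.

Lemma point_ex v : v != 0 -> exists p, hcoord p v.
Proof.
move=> v0; have dv : \dim <[v]> == 1 by rewrite dim_vline v0.
by exists (exist _ <[v]>%VS dv); rewrite /hcoord v0 memv_line.
Qed.

Lemma hcoord_proportional p v w i j :
    (v != 0 -> hcoord p v) -> (w != 0 -> hcoord p w) ->
  v i 0 * w j 0 = v j 0 * w i 0.
Proof.
have [-> _ _|v0 /(_ isT) pv] := eqVneq v 0; first by rewrite !mxE !mul0r.
have [-> _|w0 /(_ isT) pw] := eqVneq w 0; first by rewrite !mxE !mulr0.
by have [c _ ->] := hcoord_scale pv pw; rewrite !mxE; ring.
Qed.

Lemma hcoord_mx_act (A : 'M[K]_3) (uA : A \in unitmx) p v :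
  hcoord p v -> hcoord (mx_act uA p) (A *m v).
Proof.
case/andP => v0 vp; apply/andP; split.
  by apply: contraNneq v0 => Av0; rewrite -[v](mulKmx uA) Av0 mulmx0.
by rewrite /= /mx_image -[A *m v](@lfunE _ _ _ (mulmx A)) memv_img.
Qed.

End ProjectivePoints.

Section RepresentingForms.
(* [ev g v P] is the value at (g, v) of P, an element of A = K[b, t][x, y, z];
   A is abstract because unification in the nested type is very slow. *)
Variables (K : fieldType) (A : idomainType) (T : Type).
Variable ev : T -> 'cV[K]_3 -> A -> K.
Hypothesis evM : forall g v, {morph ev g v : x y / x * y}.
Hypothesis evB : forall g v, {morph ev g v : x y / x - y}.
Hypothesis ev_eq0 : forall x, (forall g v, v != 0 -> ev g v x = 0) -> x = 0.
Variable a : T -> P2 K -> P2 K.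
Implicit Types (F H : 'I_3 -> A).

Definition ev_vec F g v : 'cV[K]_3 := \col_i ev g v (F i).

Definition represents F :=
  forall g q v, hcoord q v -> ev_vec F g v != 0 -> hcoord (a g q) (ev_vec F g v).

(** Where both triples are nonzero they are coordinates of one point, and elsewhere the minors
    vanish trivially; so the minors vanish at all points and are zero. *)
Lemma represents_proportional F F' :
  represents F -> represents F' -> proportional F F'.
Proof.
move=> repF repF' i j; apply/eqP; rewrite -subr_eq0; apply/eqP.
apply: ev_eq0 => g v v0; have [q qv] := point_ex v0.
rewrite evB !evM; apply/eqP; rewrite subr_eq0; apply/eqP.
have := hcoord_proportional i j (repF g q v qv) (repF' g q v qv).
by rewrite !mxE.
Qed.

Lemma ev_vec_mul F H h g v :
  (forall i, F i = h * H i) -> ev_vec F g v = ev g v h *: ev_vec H g v.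
Proof. by move=> DF; apply/matrixP => i j; rewrite !mxE DF evM. Qed.

Lemma represents_factor F H h : (forall i, F i = h * H i) -> represents F ->
  forall g q v, hcoord q v -> ev_vec F g v != 0 ->
  ev_vec H g v != 0 /\ hcoord (a g q) (ev_vec H g v).
Proof.
move=> DF repF g q v qv Fv0; have := repF g q v qv Fv0.
move: Fv0; rewrite (ev_vec_mul g v DF) scaler_eq0 => /norP[h0 H0].
by rewrite hcoordZ.
Qed.

Lemma represents_generator (fA : factorial A) F0 i0 : F0 i0 != 0 -> represents F0 ->
  exists c H, [/\ c != 0, forall i, F0 i = c * H i
    & forall F, represents F -> exists h, forall i, F i = h * H i].
Proof.
move=> F0i0 repF0; have [c [H [c0 DF0 primH]]] := primitive_part fA F0i0.
have H0 : H i0 != 0 by apply: contraNneq F0i0 => H00; rewrite DF0 H00 mulr0.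
exists c, H; split=> // F repF.
apply: (proportional_primitive fA H0 primH) => i j.
apply: (mulfI c0); have := represents_proportional repF repF0 i j.
by rewrite !DF0 => E; rewrite mulrCA E; ring.
Qed.

Variable hom : nat -> A -> Prop.
Hypothesis hom0 : forall n, hom n 0.
Hypothesis hom_uniq : forall x m n, x != 0 -> hom m x -> hom n x -> m = n.
Hypothesis hom_factors : forall x y n, x * y != 0 -> hom n (x * y) ->
  exists k l, [/\ hom k x, hom l y & n = (k + l)%N].
Hypothesis ev_scale : forall n x g c v, hom n x -> ev g (c *: v) x = c ^+ n * ev g v x.

(** At each point some local formula does not vanish; being a multiple of [H], it forces [H] not to
    vanish there and to give the same image. *)
Lemma represents_global (fA : factorial A) (g0 : T) :
    (forall g p, exists (n : nat) F, [/\ forall i, hom n (F i),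
       exists2 v, hcoord p v & ev_vec F g v != 0 & represents F]) ->
  exists (n : nat) H, [/\ forall i, hom n (H i),
    forall g v, v != 0 -> ev_vec H g v != 0
    & forall g q v, hcoord q v -> hcoord (a g q) (ev_vec H g v)].
Proof.
have ev0 g v : ev g v 0 = 0 by rewrite -(subrr 0) evB subrr.
move=> reg_a; have [p0 _] : exists p, hcoord p (const_mx 1 : 'cV[K]_3).
  by apply: point_ex; apply/negP => /eqP/matrixP/(_ 0 0)/eqP; rewrite !mxE oner_eq0.
have [n0 [F0 [homF0 [v0 _ F0v0] repF0]]] := reg_a g0 p0.
have [i0 F0i0] : exists i, F0 i != 0.
  apply/existsP; apply: contraNT F0v0 => /existsPn F00; apply/eqP/matrixP => i j.
  by rewrite !mxE (eqP (negPn (F00 i))) ev0.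
have [c [H [c0 DF0 genH]]] := represents_generator fA F0i0 repF0.
have [k [n [homc _ Dn0]]] : exists k l, [/\ hom k c, hom l (H i0) & n0 = (k + l)%N].
  by apply: hom_factors; rewrite -DF0.
(* The degree of a nonzero [H i] is [n0] minus the degree of the common factor [c], hence does not
   depend on [i]. *)
have homH i : hom n (H i).
  have [->//|Hi0] := eqVneq (H i) 0.
  have [||k' [l [homc' homHi Dn0']]] := @hom_factors c (H i) n0.
  - exact: mulf_neq0.
  - by rewrite -DF0.
  suff -> : n = l by [].
  by apply/eqP; rewrite -(eqn_add2l k) -Dn0 Dn0' (hom_uniq c0 homc homc').
have main g q v : hcoord q v -> ev_vec H g v != 0 /\ hcoord (a g q) (ev_vec H g v).
  move=> qv; have [m [F [homF [w qw Fw0] repF]]] := reg_a g q.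
  have [h DF] := genH F repF; apply: (represents_factor DF repF qv).
  have [e e0 Dw] := hcoord_scale qv qw.
  apply: contraNneq Fw0 => Fv0; apply/eqP/matrixP => i j.
  move/matrixP/(_ i 0): Fv0; rewrite !mxE Dw (ev_scale _ _ _ (homF i)) => ->.
  by rewrite mulr0.
exists n, H; split=> [//|g v v0'|g q v qv]; last by case: (main g q v qv).
by have [q qv] := point_ex v0'; case: (main g q v qv).
Qed.

End RepresentingForms.

Section GlobalForms.
Variables (K : closedFieldType) (d : int).
Local Notation G := (G K d).
Implicit Types (g : G) (v : 'cV[K]_3).

(** Multiplication by a coordinate removes the restriction to nonzero vectors. *)
Lemma eval3_all_eq0 (p : {mpoly K[3]}) :
  (forall v, v != 0 -> eval3 p v = 0) -> p = 0.
Proof.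
move=> p0; suff /eqP : p * 'X_0 = 0.
  rewrite mulf_eq0 => /orP[/eqP //|/eqP/(congr1 (meval (fun=> 1)))/eqP].
  by rewrite mevalXU meval0 oner_eq0.
apply: meval_all_eq0 => v; rewrite mevalM mevalXU.
have [->|v0] := eqVneq (v 0) 0; first by rewrite mulr0.
have w0 : \col_i v i != 0 by apply: contraNneq v0 => /matrixP/(_ 0 0); rewrite !mxE => ->.
have vE : (fun i => (\col_i v i) i 0) =1 v by move=> i; rewrite mxE.
by have := p0 _ w0; rewrite /eval3 (meval_eq p vE) => ->; rewrite mul0r.
Qed.

(** Multiplication by t, the variable ['X_1], covers the points with t = 0, which lie outside the
    group. *)
Lemma evalG_all_eq0 (p : {mpoly K[2]}) :
  (forall g, p.@[gcoord g] = 0) -> p = 0.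
Proof.
move=> p0; suff /eqP : p * 'X_1 = 0.
  rewrite mulf_eq0 => /orP[/eqP //|/eqP/(congr1 (meval (fun=> 1)))/eqP].
  by rewrite mevalXU meval0 oner_eq0.
apply: meval_all_eq0 => v; rewrite mevalM mevalXU.
have [->|v1] := eqVneq (v 1) 0; first by rewrite mulr0.
have := p0 (mkG d (v 0) v1); rewrite (meval_eq (v2 := v)) => [->|]; first by rewrite mul0r.
by case=> [[|[|i]]] // ltI; rewrite /gcoord (tnth_nth 0) /=; congr v; apply: val_inj.
Qed.

Lemma evalGv_all_eq0 (F : {mpoly {mpoly K[2]}[3]}) :
    (forall g v, v != 0 -> eval3 (map_mpoly (meval (gcoord g)) F) v = 0) ->
  F = 0.
Proof.
move=> F0; apply/mpolyP => m; rewrite mcoeff0; apply: evalG_all_eq0 => g.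
by rewrite -mcoeff_map_mpoly (eval3_all_eq0 (F0 g)) mcoeff0.
Qed.

Lemma eval3_homog n (F : {mpoly K[3]}) c v : F \is n.-homog ->
  eval3 F (c *: v) = c ^+ n * eval3 F v.
Proof.
move=> homF; rewrite /eval3 !mevalE mulr_sumr big_seq [RHS]big_seq.
apply: eq_bigr => m /(dhomog_mf homF) /= Dn.
rewrite mulrCA; congr (_ * _); rewrite -Dn mdegE -prodrXr -big_split /=.
by apply: eq_bigr => i _; rewrite mxE exprMn.
Qed.

Lemma map_mpoly_homog n (F : {mpoly {mpoly K[2]}[3]}) g : F \is n.-homog ->
  map_mpoly (meval (gcoord g)) F \is n.-homog.
Proof.
move=> homF; apply/dhomogP => m; rewrite mcoeff_msupp mcoeff_map_mpoly => Fm0.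
apply: (dhomog_mf homF); rewrite mcoeff_msupp.
by apply: contraNneq Fm0 => ->; apply/eqP; exact: meval0.
Qed.

Lemma evalG_mul g v (P Q : {mpoly {mpoly K[2]}[3]}) :
  eval3 (map_mpoly (meval (gcoord g)) (P * Q)) v =
  eval3 (map_mpoly (meval (gcoord g)) P) v * eval3 (map_mpoly (meval (gcoord g)) Q) v.
Proof. by rewrite (rmorphM (map_mpoly (meval (gcoord g)))) /eval3 mevalM. Qed.

Lemma evalG_sub g v (P Q : {mpoly {mpoly K[2]}[3]}) :
  eval3 (map_mpoly (meval (gcoord g)) (P - Q)) v =
  eval3 (map_mpoly (meval (gcoord g)) P) v - eval3 (map_mpoly (meval (gcoord g)) Q) v.
Proof. by rewrite (raddfB (map_mpoly (meval (gcoord g)))) /eval3 mevalB. Qed.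

Variable a : G -> P2 K -> P2 K.

Let evG g v (P : {mpoly {mpoly K[2]}[3]}) := eval3 (map_mpoly (meval (gcoord g)) P) v.

Lemma global_form : regular_action a ->
  exists (n : nat) (F : 'I_3 -> {mpoly {mpoly K[2]}[3]}),
    [/\ forall i, F i \is n.-homog, forall g v, v != 0 -> evalGv F g v != 0
      & forall g q v, hcoord q v -> hcoord (a g q) (evalGv F g v)].
Proof.
apply: (@represents_global K {mpoly {mpoly K[2]}[3]} G evG
  evalG_mul evalG_sub evalGv_all_eq0 a (fun n F => is_true (F \is n.-homog)) _ _ _ _ _ 1%g).
- by move=> n; exact: rpred0.
- by move=> x m n x0 homm homn; exact: dhomog_uniq homm homn.
- exact: homog_factors.
- by move=> n x g c v homx; apply: eval3_homog; apply: map_mpoly_homog.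
exact: (@factorial_mpoly 3 _ (@factorial_mpoly 2 _ (@factorial_field K))).
Qed.

End GlobalForms.

(** * Nowhere vanishing polynomials in one variable *)

Section UnivariatePolynomials.
Variable K : closedFieldType.
Implicit Types p q : {poly K}.

Lemma horner_neq0_const p : (forall x, p.[x] != 0) -> exists2 c, c != 0 & p = c%:P.
Proof.
move=> p0; apply/size_poly1P; apply/negPn/negP => /closed_rootP [x /rootP px].
by move: (p0 x); rewrite px eqxx.
Qed.

Lemma horner_eq0_off0 p : (forall x, x != 0 -> p.[x] = 0) -> p = 0.
Proof.
move=> p0; apply/eqP; suff : p * 'X == 0 by rewrite mulf_eq0 polyX_eq0 orbF.
apply/negPn/negP => /closed_nonrootP [x]; rewrite /root hornerMX mulf_eq0.
by have [->|/p0 ->] := eqVneq x 0; rewrite ?eqxx ?orbT.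
Qed.

Lemma horner_neq0_monomial p : (forall x, x != 0 -> p.[x] != 0) ->
  exists c k, c != 0 /\ p = c%:P * 'X^k.
Proof.
have [n] := ubnP (size p); elim: n p => // n IHn p szp p0.
have [/factor_theorem [q Dp]|p00] := boolP (root p 0); last first.
  have [x|c c0 Dp] := @horner_neq0_const p; last by exists c, 0; rewrite expr0 mulr1.
  by have [->|/p0 //] := eqVneq x 0.
rewrite subr0 in Dp.
have q0 : q != 0.
  by apply: contraNneq (p0 1 (oner_neq0 K)) => q0; rewrite Dp q0 mul0r horner0.
have [||c [k [c0 Dq]]] := IHn q.
- by move: szp; rewrite Dp size_mulX.
- by move=> x /p0; rewrite Dp hornerM mulf_eq0 => /norP[].
by exists c, k.+1; rewrite Dp Dq exprSr mulrA.
Qed.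

Lemma expr_all1 n : (forall x : K, x != 0 -> x ^+ n = 1) -> n = 0.
Proof.
case: n => // n x1; have /polyP/(_ n.+1) : 'X^(n.+1) - 1 = 0 :> {poly K}.
  by apply: horner_eq0_off0 => x /x1; rewrite !hornerE => ->; rewrite subrr.
by rewrite coefB coefXn coef1 coef0 eqxx subr0 => /eqP; rewrite oner_eq0.
Qed.

Lemma exprz_all1 (m : int) : (forall x : K, x != 0 -> x ^ m = 1) -> m = 0.
Proof.
move=> x1; apply/eqP; rewrite -absz_eq0; apply/eqP/expr_all1 => x x0.
have := x1 x x0; case: m {x1} => k //= xk.
by apply: invr_inj; rewrite invr1 -xk.
Qed.

(** Restriction to a parametrized curve, used for the line z = 0 and for the two one-parameter
    subgroups. *)
Definition substX n (w : 'I_n -> {poly K}) : {mpoly K[n]} -> {poly K} := mmap polyC w.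

Lemma horner_substX n (w : 'I_n -> {poly K}) f x :
  (substX w f).[x] = f.@[fun i => (w i).[x]].
Proof.
rewrite /substX /mmap mevalE horner_sum; apply: eq_bigr => m _.
rewrite hornerM hornerC /mmap1 horner_prod; congr (_ * _).
by apply: eq_bigr => i _; rewrite horner_exp.
Qed.

End UnivariatePolynomials.

Section LinearForms.
Variable R : comNzRingType.

Lemma homog1_sum n (f : {mpoly R[n]}) : f \is 1.-homog ->
  f = \sum_i f@_(U_(i)) *: 'X_i.
Proof.
move=> homf; apply/mpolyP => m; rewrite raddf_sum /=.
have [|m1] := eqVneq (mdeg m) 1%N.
  move/eqP; rewrite mdeg_eq1 => /existsP [i /eqP ->].
  rewrite (bigD1 i) //= mcoeffZ mcoeffX eqxx mulr1 big1 ?addr0 // => j ji.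
  by rewrite mcoeffZ mcoeffX eq_mnm1 (negPf ji) mulr0.
rewrite (dhomog_nemf_coeff homf m1) big1 // => i _.
rewrite mcoeffZ mcoeffX; case: eqP => [Um|_]; last by rewrite mulr0.
by rewrite -Um mdeg1 eqxx in m1.
Qed.

End LinearForms.

Lemma unitmx_ker0 (F : fieldType) n (M : 'M[F]_n) :
  (forall v : 'cV_n, M *m v = 0 -> v = 0) -> M \in unitmx.
Proof.
move=> M0; rewrite -unitmx_tr -row_free_unit -kermx_eq0.
apply/rowV0P => v /sub_kermxP vM; apply: trmx_inj; rewrite trmx0; apply: M0.
by rewrite -[M]trmxK -trmx_mul vM trmx0.
Qed.

(** * The action is linear in the coordinates *)

Section LinearAction.
Variables (K : closedFieldType) (d : int).
Local Notation G := (G K d).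
Variable a : G -> P2 K -> P2 K.

(** The line z = 0 suffices. There f_1(x, 1, 0) has no zero, so it is a constant c. Homogeneity
    turns f_0(1/x, 1, 0) = c/x into x f_0(1, x, 0) = c x^n; since f_0(1, 0, 0) is nonzero, comparing
    orders at 0 gives n = 1. *)
Lemma endomorphism_degree1 n (f : 'I_3 -> {mpoly K[3]}) :
    (forall i, f i \is n.-homog) ->
    (forall v : 'cV_3, v != 0 -> exists2 c, c != 0 & evalv f v = c *: v) ->
  n = 1%N.
Proof.
move=> homf fv.
pose vec3 (x y : K) : 'cV[K]_3 := \col_(i < 3) [:: x; y; 0]`_i.
have vec3_0 x y : vec3 x y != 0 -> exists c, [/\ c != 0,
    eval3 (f 0) (vec3 x y) = c * x & eval3 (f 1) (vec3 x y) = c * y].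
  move=> /fv [c c0 E]; exists c; split=> //.
    by move/matrixP/(_ 0 0): E; rewrite !mxE.
  by move/matrixP/(_ 1 0): E; rewrite !mxE.
have vx x y : x != 0 -> vec3 x y != 0.
  by apply: contraNneq => /matrixP/(_ 0 0); rewrite !mxE /= => ->.
have vy x y : y != 0 -> vec3 x y != 0.
  by apply: contraNneq => /matrixP/(_ 1 0); rewrite !mxE /= => ->.
have substE (w : 'I_3 -> {poly K}) i x : (substX w (f i)).[x] =
    eval3 (f i) (\col_j (w j).[x]).
  by rewrite horner_substX /eval3; apply: meval_eq => j; rewrite !mxE.
pose p := substX (fun i : 'I_3 => [:: 'X; 1; 0]`_i) (f 1).
pose q := substX (fun i : 'I_3 => [:: 1; 'X; 0]`_i) (f 0).
have pE x : p.[x] = eval3 (f 1) (vec3 x 1).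
  rewrite substE; congr eval3; apply/matrixP => -[[|[|[|i]]] //= ?] j;
    by rewrite !mxE /= !hornerE.
have qE x : q.[x] = eval3 (f 0) (vec3 1 x).
  rewrite substE; congr eval3; apply/matrixP => -[[|[|[|i]]] //= ?] j;
    by rewrite !mxE /= !hornerE.
have [x|c c0 Dp] := @horner_neq0_const _ p.
  rewrite pE; have [c [c0 _ ->]] := vec3_0 x 1 (vy _ _ (oner_neq0 K)).
  by rewrite mulr1.
have q00 : q`_0 != 0.
  rewrite -horner_coef0 qE; have [e [e0 -> _]] := vec3_0 1 0 (vx _ _ (oner_neq0 K)).
  by rewrite mulr1.
have Dq : q * 'X = c%:P * 'X^n.
  apply/eqP; rewrite -subr_eq0; apply/eqP/horner_eq0_off0 => x x0.
  rewrite !hornerE qE.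
  have [e [_ E0 E1]] := vec3_0 x^-1 1 (vy _ _ (oner_neq0 K)).
  have Dc : c = e by rewrite -[c](hornerC c x^-1) -Dp pE E1 mulr1.
  have -> : vec3 1 x = x *: vec3 x^-1 1.
    apply/matrixP => -[[|[|[|i]]] //= ?] j;
    by rewrite !mxE /= ?mulfV ?mulr1 ?mulr0.
  rewrite (eval3_homog _ _ (homf 0)) E0 Dc.
  by rewrite -mulrA mulfVK // mulrC subrr.
move/polyP/(_ n): (Dq); rewrite coefMX coefCM coefXn eqxx mulr1.
case: n {homf} Dq => [_ /eqP|n Dq _]; first by rewrite eq_sym (negPf c0).
move/polyP/(_ 1%N): Dq; rewrite coefMX coefCM coefXn /=.
by case: n => // n /eqP; rewrite mulr0 (negPf q00).
Qed.

Lemma linear_action : is_left_action a -> regular_action a ->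
  exists L : 'I_3 -> 'I_3 -> {mpoly K[2]}, forall g,
    let M := \matrix_(i, j) (L i j).@[gcoord g] in
    M \in unitmx /\ forall q v, hcoord q v -> hcoord (a g q) (M *m v).
Proof.
move=> [a1 _] /global_form [n [F [homF F0 aF]]].
have n1 : n = 1%N.
  apply: (@endomorphism_degree1 n
    (fun i => map_mpoly (meval (gcoord (1%g : G))) (F i))) => [i|v v0].
    exact: map_mpoly_homog.
  have [p pv] := point_ex v0.
  by have := aF 1%g p v pv; rewrite a1; apply: hcoord_scale.
rewrite n1 in homF.
exists (fun i j => (F i)@_(U_(j))) => g M.
have ME v : M *m v = evalGv F g v.
  apply/matrixP => i j; rewrite !mxE /eval3.
  rewrite (homog1_sum (map_mpoly_homog g (homF i))) raddf_sum /=.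
  apply: eq_bigr => k _; rewrite mevalZ mevalXU mcoeff_map_mpoly mxE.
  by rewrite ord1.
split=> [|q v /(aF g)]; last by rewrite ME.
apply: unitmx_ker0 => v Mv0; apply/eqP; apply: contraT => /(F0 g).
by rewrite -ME Mv0 eqxx.
Qed.

End LinearAction.

(** * Lifting to a linear representation *)

Section PolynomialMatrices.
Variables (K : closedFieldType) (n : nat).
Implicit Types (A B : 'M[{poly K}]_n) (M : 'M[K]_n).

Definition mxeval A x : 'M[K]_n := map_mx (horner_eval x) A.

Lemma mxevalE A x i j : mxeval A x i j = (A i j).[x].
Proof. by rewrite mxE. Qed.

Lemma mxevalM A B x : mxeval (A *m B) x = mxeval A x *m mxeval B x.
Proof. exact: map_mxM. Qed.

Lemma mxevalZ p A x : mxeval (p *: A) x = p.[x] *: mxeval A x.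
Proof. exact: map_mxZ. Qed.

Lemma mxeval_const M x : mxeval (map_mx polyC M) x = M.
Proof. by apply/matrixP => i j; rewrite !mxE /horner_eval hornerC. Qed.

Lemma mxeval_comp A q x : mxeval (map_mx (comp_poly q) A) x = mxeval A q.[x].
Proof. by apply/matrixP => i j; rewrite !mxE /horner_eval horner_comp. Qed.

Lemma det_mxeval A x : \det (mxeval A x) = (\det A).[x].
Proof. by rewrite det_map_mx. Qed.

End PolynomialMatrices.

Section ProportionalMatrices.
Variables (K : closedFieldType) (n : nat).
Implicit Types (X Y : 'M[{poly K}]_n.+1).

(** By Cramer's rule the ratio of two proportional families is a rational function of [x] with
    denominator [\det Y], so its zeros and poles can be controlled. *)
Lemma ratio_horner X Y x c : mxeval X x = c *: mxeval Y x ->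
  ((X *m \adj Y) 0 0).[x] = c * (\det Y).[x].
Proof.
move=> XY; rewrite -mxevalE mxevalM XY.
rewrite -scalemxAl {2}/mxeval map_mx_adj -/(mxeval Y x) mul_mx_adj.
by rewrite !mxE eqxx mulr1n det_mxeval.
Qed.

Lemma proportional_mx_const X Y :
    (forall x, mxeval Y x \in unitmx) ->
    (forall x, exists2 c, c != 0 & mxeval X x = c *: mxeval Y x) ->
  exists c, forall x, mxeval X x = c *: mxeval Y x.
Proof.
move=> unitY XY.
have detY x : (\det Y).[x] != 0 by rewrite -det_mxeval -unitfE -unitmxE.
have [e e0 De] := horner_neq0_const detY.
have [x|f f0 Df] := @horner_neq0_const _ ((X *m \adj Y) 0 0).
  by have [c c0 /ratio_horner ->] := XY x; rewrite mulf_neq0.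
exists (f / e) => x; have [c _ E] := XY x; rewrite E; congr (_ *: _).
by apply: (mulIf e0); have := ratio_horner E; rewrite De Df !hornerC => ->; rewrite divfK.
Qed.

(** Numerator and denominator of the ratio vanish at most at 0, so both are monomials; the
    difference of their exponents is an integer of either sign. *)
Lemma proportional_mx_monomial X Y :
    (forall x, x != 0 -> mxeval Y x \in unitmx) ->
    (forall x, x != 0 -> exists2 c, c != 0 & mxeval X x = c *: mxeval Y x) ->
  exists c (m : int), forall x, x != 0 -> mxeval X x = (c * x ^ m) *: mxeval Y x.
Proof.
move=> unitY XY.
have detY x : x != 0 -> (\det Y).[x] != 0.
  by move=> x0; rewrite -det_mxeval -unitfE -unitmxE unitY.
have [e [k [e0 De]]] := horner_neq0_monomial detY.
have [x x0|f [l [f0 Df]]] := @horner_neq0_monomial _ ((X *m \adj Y) 0 0).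
  by have [c c0 /ratio_horner ->] := XY x x0; rewrite mulf_neq0 ?detY.
exists (f / e), (l%:Z - k%:Z) => x x0; have [c _ E] := XY x x0.
rewrite E; congr (_ *: _); apply: (mulIf e0); apply: (mulIf (expf_neq0 k x0)).
have R : c * e * x ^+ k = f * x ^+ l.
  by have := ratio_horner E; rewrite De Df !hornerM !hornerC !hornerXn mulrA.
rewrite R expfzDr // -exprnP -exprnN.
by field; rewrite e0 expf_neq0.
Qed.

End ProportionalMatrices.

Section ProjectiveMatrices.
Variables (K : closedFieldType) (d : int).
Local Notation G := (G K d).
Variable a : G -> P2 K -> P2 K.
Implicit Types (g h : G) (M N : 'M[K]_3).

(** The basis vectors show that [M] is diagonal, and the vector with all entries 1 that its diagonal
    is constant. *)
Lemma eigenvectors_scalar M :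
  (forall v : 'cV_3, v != 0 -> exists c, M *m v = c *: v) -> exists c, M = c%:M.
Proof.
move=> Mv; have offdiag i j : i != j -> M i j = 0.
  move=> ij; have [|c] := Mv (delta_mx j 0).
    by apply/negP => /eqP/matrixP/(_ j 0)/eqP; rewrite !mxE !eqxx oner_eq0.
  rewrite -colE => /matrixP/(_ i 0); rewrite !mxE (negPf ij) => ->.
  by rewrite mulr0.
have [|c Mc] := Mv (const_mx 1).
  by apply/negP => /eqP/matrixP/(_ 0 0)/eqP; rewrite !mxE oner_eq0.
exists c; apply/matrixP => i j; rewrite !mxE.
have [<-|ij] := eqVneq i j; last exact: offdiag.
move/matrixP/(_ i 0): Mc; rewrite !mxE mulr1 => <-.
rewrite (bigD1 i) //= mxE mulr1 big1 ?addr0 // => k ki.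
by rewrite offdiag ?mul0r // eq_sym.
Qed.

Definition acts_by g M :=
  M \in unitmx /\ forall q v, hcoord q v -> hcoord (a g q) (M *m v).

Lemma acts_by_uniq g M N : acts_by g M -> acts_by g N ->
  exists2 c, c != 0 & M = c *: N.
Proof.
move=> [uM aM] [uN aN].
have [v v0|c Dc] := @eigenvectors_scalar (invmx N *m M).
  have [q qv] := point_ex v0.
  have [c _ E] := hcoord_scale (aN q v qv) (aM q v qv).
  by exists c; rewrite -mulmxA E -scalemxAr mulKmx.
have DM : M = c *: N by rewrite -[M](mulKVmx uN) Dc scalar_mxC mul_scalar_mx.
exists c => //; apply: contraTneq uM => c0.
by rewrite DM c0 scale0r unitmxE det0 unitr0.
Qed.

Lemma acts_byZ g M c : c != 0 -> acts_by g M -> acts_by g (c *: M).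
Proof.
move=> c0 [uM aM]; split; first by rewrite unitmxZ // unitfE.
by move=> q v qv; rewrite -scalemxAl hcoordZ // aM.
Qed.

Hypothesis act_a : is_left_action a.

Lemma acts_by1 : acts_by 1%g 1%:M.
Proof. by split=> [|q v]; rewrite ?unitmx1 // (proj1 act_a) mul1mx. Qed.

Lemma acts_byM g h M N : acts_by g M -> acts_by h N -> acts_by (g * h)%g (M *m N).
Proof.
move=> [uM aM] [uN aN]; split=> [|q v qv]; first by rewrite unitmx_mul uM.
by rewrite (proj2 act_a) -mulmxA aM // aN.
Qed.

Definition additive_elt b : G := mkG d b (oner_neq0 K).
Definition torus_elt t (t0 : t != 0) : G := mkG d 0 t0.

Lemma additive_eltD b b' :
  additive_elt (b + b') = (additive_elt b * additive_elt b')%g.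
Proof.
by apply: eqG; rewrite /gb /gt /= ?exp1rz mul1r.
Qed.

Lemma torus_eltM s t (s0 : s != 0) (t0 : t != 0) :
  torus_elt (mulf_neq0 s0 t0) = (torus_elt s0 * torus_elt t0)%g.
Proof. by apply: eqG; rewrite // /gb /gt /= mulr0 addr0. Qed.

Lemma torus_additive t (t0 : t != 0) b :
  (torus_elt t0 * additive_elt b = additive_elt (t ^ d * b) * torus_elt t0)%g.
Proof.
apply: eqG; rewrite /gb /gt /=; last by rewrite mulr1 mul1r.
by rewrite mulr0 addr0 add0r.
Qed.

Lemma elt_decomposition g : g = (additive_elt (gb g) * torus_elt (gt_neq0 g))%g.
Proof.
by apply: eqG; rewrite /gb /gt /= ?mulr0 ?addr0 ?mul1r.
Qed.

End ProjectiveMatrices.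

Section RepresentationLift.
Variables (K : closedFieldType) (d : int).
Variable a : G K d -> P2 K -> P2 K.

(** The curves (b, 1) and (0, t) both pass through the identity, where the matrix is a scalar c;
    division by c normalizes both families at once. *)
Lemma subgroup_matrices : algebraic_action a ->
  exists U T : 'M[{poly K}]_3, [/\
    forall b, acts_by a (additive_elt d b) (mxeval U b),
    forall t (t0 : t != 0), acts_by a (torus_elt d t0) (mxeval T t),
    mxeval U 0 = 1%:M & mxeval T 1 = 1%:M].
Proof.
move=> [left_a reg_a]; have [L actL] := linear_action left_a reg_a.
pose M x y : 'M[K]_3 := \matrix_(i, j) (L i j).@[tnth [tuple x; y]].
have actM b t (t0 : t != 0) : acts_by a (mkG d b t0) (M b t).
  exact: actL (mkG d b t0).
have one1 : 1%g = mkG d 0 (oner_neq0 K) by apply: eqG.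
have [c c0 Mc] : exists2 c, c != 0 & M 0 1 = c%:M.
  have := actM 0 1 (oner_neq0 K); rewrite -one1 => act1.
  have [c c0 ->] := acts_by_uniq act1 (acts_by1 left_a).
  by exists c; rewrite // scalemx1.
pose P (w : 'I_2 -> {poly K}) := c^-1%:P *: \matrix_(i, j) substX w (L i j).
have PE w x : mxeval (P w) x = c^-1 *: M (w 0).[x] (w 1).[x].
  rewrite mxevalZ hornerC; congr (_ *: _); apply/matrixP => i j.
  rewrite !mxE /horner_eval horner_substX; apply: meval_eq => k.
  by rewrite (tnth_nth 0); case: k => -[|[|k]] //= ltk; congr (w _).[x]; apply: val_inj.
exists (P (tnth [tuple 'X; 1])), (P (tnth [tuple 0; 'X])).
have ci0 : c^-1 != 0 by rewrite invr_eq0.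
split=> [b|t t0||]; rewrite PE !(tnth_nth 0) /= !hornerE.
- by apply: acts_byZ => //; apply: actM.
- by apply: acts_byZ => //; apply: actM.
- by rewrite Mc scale_scalar_mx mulVf.
- by rewrite Mc scale_scalar_mx mulVf.
Qed.

Lemma scale_unitmx_id n (M : 'M[K]_n.+1) c : M \in unitmx -> M = c *: M -> c = 1.
Proof.
move=> uM /(congr1 (mulmx (invmx M))); rewrite -scalemxAr mulVmx //.
by move/matrixP/(_ 0 0); rewrite !mxE mulr1.
Qed.

Lemma representation_lift : algebraic_action a ->
  exists U T : 'M[{poly K}]_3, [/\
    forall b t (t0 : t != 0), acts_by a (mkG d b t0) (mxeval U b *m mxeval T t),
    mxeval U 0 = 1%:M /\ forall b b', mxeval U b *m mxeval U b' = mxeval U (b + b'),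
    mxeval T 1 = 1%:M /\ forall s t, s != 0 -> t != 0 ->
      mxeval T s *m mxeval T t = mxeval T (s * t)
    & forall b t, t != 0 ->
      mxeval T t *m mxeval U b = mxeval U (t ^ d * b) *m mxeval T t].
Proof.
move=> alg_a; have [U [T [actU actT U0 T1]]] := subgroup_matrices alg_a.
have [left_a _] := alg_a; exists U, T.
have unitU b : mxeval U b \in unitmx by case: (actU b).
have unitT t : t != 0 -> mxeval T t \in unitmx by move=> t0; case: (actT t t0).
split.
- move=> b t t0; have := elt_decomposition (mkG d b t0).
  rewrite (_ : torus_elt _ _ = torus_elt d t0); last exact: eqG.
  by move->; apply: acts_byM.
- split=> // b b'.
  (* One argument is fixed and the other varies, so that the cocycle is a ratio of two polynomial
     families in one variable. Its value at 0 is 1. *)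
  have [x|x|c E] := @proportional_mx_const _ _
    (map_mx polyC (mxeval U b) *m U) (map_mx (comp_poly (b%:P + 'X)) U).
  + by rewrite mxeval_comp.
  + rewrite mxevalM mxeval_const mxeval_comp hornerD hornerC hornerX.
    apply: (acts_by_uniq (acts_byM left_a (actU b) (actU x))).
    by rewrite -additive_eltD.
  have := E 0; have := E b'.
  rewrite !mxevalM !mxeval_const !mxeval_comp !hornerD !hornerC !hornerX addr0 U0 mulmx1 => ->.
  by move/(scale_unitmx_id (unitU b)) => ->; rewrite scale1r.
- split=> // s t s0 t0.
  have [k [m E]] : exists c m, forall x, x != 0 ->
      mxeval (map_mx polyC (mxeval T s) *m T) x =
        (c * x ^ m) *: mxeval (map_mx (comp_poly (s%:P * 'X)) T) x.
    apply: proportional_mx_monomial => x x0.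
      by rewrite mxeval_comp unitT // hornerM hornerC hornerX mulf_neq0.
    rewrite mxevalM mxeval_const mxeval_comp hornerM hornerC hornerX.
    apply: (acts_by_uniq (acts_byM left_a (actT s s0) (actT x x0))).
    by rewrite -torus_eltM.
  have {}E x : x != 0 -> mxeval T s *m mxeval T x = (k * x ^ m) *: mxeval T (s * x).
    by move/E; rewrite mxevalM mxeval_const mxeval_comp hornerM hornerC hornerX.
  have k1 : k = 1.
    apply: (scale_unitmx_id (unitT s s0)).
    by have := E 1 (oner_neq0 K); rewrite T1 mulmx1 !mulr1 exp1rz mulr1.
  (* [\det T] is a monomial with coefficient 1, hence multiplicative; taking determinants in [E]
     leaves x^(3m) = 1. *)
  suff m0 : m = 0 by rewrite E // k1 m0 expr0z mulr1 scale1r.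
  have detT x : x != 0 -> (\det T).[x] != 0.
    by move=> x0; rewrite -det_mxeval -unitfE -unitmxE unitT.
  have [e [l [e0 De]]] := horner_neq0_monomial detT.
  have e1 : e = 1.
    have := det_mxeval T 1.
    by rewrite T1 det1 De hornerM hornerC hornerXn expr1n mulr1.
  have det3 (x : K) : x != 0 -> x ^ (m * 3) = 1.
    move=> x0.
    rewrite -exprz_exp -exprnP.
    move: x0 (congr1 determinant (E x x0)) => x0.
    rewrite det_mulmx detZ !det_mxeval De e1 k1 !mul1r !hornerXn exprMn.
    move/esym; rewrite -[X in _ = X -> _]mul1r => /mulIf -> //.
    by rewrite mulf_neq0 // expf_neq0.
  by have /eqP := exprz_all1 det3; rewrite mulf_eq0 orbF => /eqP.
- move=> b t t0.
  have [x|x|c E] := @proportional_mx_const _ _ (map_mx polyC (mxeval T t) *m U)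
    (map_mx (comp_poly ((t ^ d)%:P * 'X)) U *m map_mx polyC (mxeval T t)).
  + by rewrite mxevalM mxeval_const mxeval_comp unitmx_mul unitU unitT.
  + rewrite !mxevalM !mxeval_const mxeval_comp hornerM hornerC hornerX.
    apply: (acts_by_uniq (acts_byM left_a (actT t t0) (actU x))).
    by rewrite torus_additive; apply: acts_byM.
  have {}E x : mxeval T t *m mxeval U x = c *: (mxeval U (t ^ d * x) *m mxeval T t).
    by have := E x; rewrite !mxevalM !mxeval_const mxeval_comp hornerM hornerC hornerX.
  suff c1 : c = 1 by rewrite E c1 scale1r.
  apply: (scale_unitmx_id (unitT t t0)).
  by have := E 0; rewrite mulr0 U0 mulmx1 mul1mx.
Qed.

End RepresentationLift.

(** * Classification of the representations *)

Section WeightDecomposition.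
Variables (K : closedFieldType) (n : nat).
Implicit Types (A B : 'M[{poly K}]_n).

(** For [T] below these are the projectors onto the weight spaces; for [U] the one of index 1 is the
    infinitesimal generator. *)
Definition coefmx A k : 'M[K]_n := \matrix_(i, j) (A i j)`_k.

Lemma mxeval_inj_off0 A B : (forall x, x != 0 -> mxeval A x = mxeval B x) -> A = B.
Proof.
move=> AB; apply/matrixP => i j; apply/eqP; rewrite -subr_eq0; apply/eqP.
apply: horner_eq0_off0 => x /AB/matrixP/(_ i j).
by rewrite !mxE /horner_eval hornerD hornerN => ->; rewrite subrr.
Qed.

Lemma mxeval_coefmx A N x : (forall i j, size (A i j) <= N)%N ->
  mxeval A x = \sum_(k < N) x ^+ k *: coefmx A k.
Proof.
move=> szA; apply/matrixP => i j; rewrite summxE mxevalE (horner_coef_wide _ (szA i j)).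
by apply: eq_bigr => k _; rewrite !mxE mulrC.
Qed.

Lemma size_mx_bound A : exists N, forall i j, (size (A i j) <= N)%N.
Proof.
exists (\max_i \max_j size (A i j))%N => i j.
exact: leq_trans (leq_bigmax j) (leq_bigmax (F := fun i => \max_j size (A i j))%N i).
Qed.

Lemma coefmxMl (M : 'M[K]_n) A k : coefmx (map_mx polyC M *m A) k = M *m coefmx A k.
Proof.
apply/matrixP => i j; rewrite !mxE coef_sum; apply: eq_bigr => l _.
by rewrite !mxE coefCM.
Qed.

Lemma coefmxMr (M : 'M[K]_n) A k : coefmx (A *m map_mx polyC M) k = coefmx A k *m M.
Proof.
apply/matrixP => i j; rewrite !mxE coef_sum; apply: eq_bigr => l _.
by rewrite !mxE coefMC.
Qed.

Lemma coefmx_mulv A (v : 'cV[K]_n) k :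
  (forall x, x != 0 -> mxeval A x *m v = 0) -> coefmx A k *m v = 0.
Proof.
move=> Av; apply/matrixP => i j; rewrite !mxE.
have -> : \sum_l coefmx A k i l * v l j = (\sum_l A i l * (v l j)%:P)`_k.
  by rewrite coef_sum; apply: eq_bigr => l _; rewrite coefMC mxE.
suff -> : \sum_l A i l * (v l j)%:P = 0 by rewrite coef0.
apply: horner_eq0_off0 => x /Av/matrixP/(_ i j).
rewrite !mxE => <-; rewrite horner_sum; apply: eq_bigr => l _.
by rewrite hornerM hornerC !mxE.
Qed.

Lemma coef_comp_polyCX (p : {poly K}) c k : (p \Po (c%:P * 'X))`_k = c ^+ k * p`_k.
Proof.
rewrite coef_comp_poly.
under eq_bigr => i _.
  rewrite exprMn -rmorphXn coefCM coefXn.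
  over.
have [ksz|szk] := ltnP k (size p).
  rewrite (bigD1 (Ordinal ksz)) //= eqxx mulr1 mulrC big1 ?addr0 // => i ik.
  case: eqP => [ki|_]; last by rewrite !mulr0.
  by case/eqP: ik; apply: val_inj.
rewrite (nth_default 0 szk) mulr0 big1 // => i _.
case: eqP => [ki|_]; last by rewrite !mulr0.
by move: (ltn_ord i); rewrite -ki ltnNge szk.
Qed.

Lemma coefmx_comp A c k :
  coefmx (map_mx (comp_poly (c%:P * 'X)) A) k = c ^+ k *: coefmx A k.
Proof. by apply/matrixP => i j; rewrite !mxE coef_comp_polyCX. Qed.

Variable T : 'M[{poly K}]_n.
Hypothesis T1 : mxeval T 1 = 1%:M.
Hypothesis TM : forall s t, s != 0 -> t != 0 ->
  mxeval T s *m mxeval T t = mxeval T (s * t).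

(** The coefficients of x^k in T(t) T(x) = T(t x) are compared. *)
Lemma weight_coefmx t k : t != 0 -> mxeval T t *m coefmx T k = t ^+ k *: coefmx T k.
Proof.
move=> t0; rewrite -coefmxMl -coefmx_comp; congr (coefmx _ k).
apply: mxeval_inj_off0 => s s0.
by rewrite mxevalM mxeval_const mxeval_comp hornerM hornerC hornerX TM.
Qed.

Lemma weight_decomposition (v : 'cV[K]_n) : exists N,
  v = \sum_(k < N) coefmx T k *m v.
Proof.
have [N szT] := size_mx_bound T; exists N.
rewrite -mulmx_suml -{1}[v]mul1mx -T1 (mxeval_coefmx _ szT); congr (_ *m _).
by apply: eq_bigr => k _; rewrite expr1n scale1r.
Qed.

End WeightDecomposition.

Section OneParameterUnipotent.
Variables (K : closedFieldType) (n : nat).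
Variable U : 'M[{poly K}]_n.
Hypothesis UD : forall b b', mxeval U b *m mxeval U b' = mxeval U (b + b').

(** Differentiating U(b) U(x) = U(b + x) at x = 0 gives the differential equation U' = U N with N =
    [coefmx U 1], read here coefficient by coefficient. *)
Lemma coefmx_recursion k : coefmx U k *m coefmx U 1 = k.+1%:R *: coefmx U k.+1.
Proof.
rewrite -coefmxMr.
have -> : U *m map_mx polyC (coefmx U 1) = map_mx (@deriv K) U.
  apply: mxeval_inj_off0 => b _; rewrite mxevalM mxeval_const -coefmxMl.
  have -> : map_mx polyC (mxeval U b) *m U = map_mx (comp_poly (b%:P + 'X)) U.
    apply: mxeval_inj_off0 => x _.
    by rewrite mxevalM mxeval_const mxeval_comp hornerD hornerC hornerX UD.
  apply/matrixP => i j; rewrite !mxE /horner_eval.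
  have := horner_coef0 (U i j \Po (b%:P + 'X))^`().
  rewrite coef_deriv mulr1n => <-; rewrite deriv_comp derivD derivC derivX add0r mulr1.
  by rewrite horner_comp hornerD hornerC hornerX addr0.
by apply/matrixP => i j; rewrite !mxE coef_deriv mulr_natl.
Qed.

End OneParameterUnipotent.

(** All eigenvalues are 0, so the characteristic polynomial is X^(n+1) and the theorem of Cayley and
    Hamilton applies. *)
Lemma nilpotent_mx_exp (K : closedFieldType) n (N : 'M[K]_n.+1) m :
  N ^+ m = 0 -> N ^+ n.+1 = 0.
Proof.
move=> Nm; have eig0 x : root (char_poly N) x -> x = 0.
  rewrite -eigenvalue_root_char => /eigenvalueP [v vN v0].
  have vNm k : v *m N ^+ k = x ^+ k *: v.
    elim: k => [|k IHk]; first by rewrite !expr0 mulmx1 scale1r.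
    by rewrite exprSr mulmxA IHk -scalemxAl vN scalerA -exprSr.
  have /eqP := vNm m; rewrite Nm mulmx0 eq_sym scaler_eq0 (negPf v0) orbF.
  by rewrite expf_eq0 => /andP[_ /eqP].
have [r Dr] := closed_field_poly_normal (char_poly N).
have lead1 : lead_coef (char_poly N) = 1 by apply/eqP; exact: char_poly_monic.
rewrite lead1 scale1r in Dr.
have r0 : {in r, forall z, z = 0}.
  by move=> z zr; apply: eig0; rewrite Dr root_prod_XsubC.
have DX : char_poly N = 'X^(size r).
  rewrite Dr big_seq (eq_bigr (fun=> 'X)) => [|z /r0 ->]; last by rewrite subr0.
  by rewrite -big_seq big_const_seq count_predT iter_mulr_1.
have sr : size r = n.+1.
  by have := size_char_poly N; rewrite DX size_polyXn => -[].
by have := Cayley_Hamilton N; rewrite DX sr rmorphXn /= horner_mx_X.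
Qed.

Section Columns.
Variable K : fieldType.
Implicit Types (u v w : 'cV[K]_3).

Definition cols3 u v w : 'M[K]_3 := \matrix_(i, j) [:: u i 0; v i 0; w i 0]`_j.

Lemma cols3_mulv u v w (x : 'cV[K]_3) :
  cols3 u v w *m x = x 0 0 *: u + x 1 0 *: v + x (inord 2) 0 *: w.
Proof.
apply/matrixP => i j; rewrite ord1 !mxE !big_ord_recl big_ord0 !mxE /= addr0 addrA.
rewrite ![_ * x _ _]mulrC; congr (_ * _ + x _ _ * _ + x _ _ * _); apply: val_inj => //=.
by rewrite inordK.
Qed.

Lemma mulmx_cols3 (A : 'M[K]_3) u v w :
  A *m cols3 u v w = cols3 (A *m u) (A *m v) (A *m w).
Proof.
apply/matrixP => i [[|[|[|j]]] //= ltj]; rewrite !mxE /=;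
  by apply: eq_bigr => k _; rewrite !mxE.
Qed.

Lemma cols3_mx3 u v w (x y z r s t : K) :
  cols3 u v w *m mx3 [:: [:: x; r; s]; [:: 0; y; t]; [:: 0; 0; z]] =
  cols3 (x *: u) (r *: u + y *: v) (s *: u + t *: v + z *: w).
Proof.
apply/matrixP => i [[|[|[|j]]] //= ltj]; rewrite !mxE !big_ord_recl big_ord0 !mxE /=; ring.
Qed.

Lemma scale_cols3 c u v w : c *: cols3 u v w = cols3 (c *: u) (c *: v) (c *: w).
Proof. by apply/matrixP => i [[|[|[|j]]] //= ltj]; rewrite !mxE. Qed.

Lemma cols3_unit u v w :
    (forall x y z, x *: u + y *: v + z *: w = 0 -> [/\ x = 0, y = 0 & z = 0]) ->
  cols3 u v w \in unitmx.
Proof.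
move=> free; apply: unitmx_ker0 => x; rewrite cols3_mulv => /free[x0 x1 x2].
apply/matrixP => -[[|[|[|i]]] //= lti] j; rewrite ord1 mxE.
- by rewrite -[RHS]x0; congr (x _ _); apply: val_inj.
- by rewrite -[RHS]x1; congr (x _ _); apply: val_inj.
- by rewrite -[RHS]x2; congr (x _ _); apply: val_inj => /=; rewrite inordK.
Qed.

End Columns.

(** * Bases of weight vectors *)

Section WeightBasis.
Variables (K : closedFieldType) (d : int).
Hypothesis charK0 : [pchar K] =i pred0.
Variables U T : 'M[{poly K}]_3.
Hypothesis U0 : mxeval U 0 = 1%:M.
Hypothesis UD : forall b b', mxeval U b *m mxeval U b' = mxeval U (b + b').
Hypothesis T1 : mxeval T 1 = 1%:M.
Hypothesis TM : forall s t, s != 0 -> t != 0 ->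
  mxeval T s *m mxeval T t = mxeval T (s * t).
Hypothesis TU : forall b t, t != 0 ->
  mxeval T t *m mxeval U b = mxeval U (t ^ d * b) *m mxeval T t.

Let N := coefmx U 1.

Lemma natK_neq0 k : k.+1%:R != 0 :> K.
Proof. by have [+ _] := pcharf0P K; move/(_ charK0) ->. Qed.

Lemma coefmx_powers k : k`!%:R *: coefmx U k = N ^+ k.
Proof.
elim: k => [|k IHk].
  rewrite scale1r expr0; apply/matrixP => i j; rewrite mxE -horner_coef0.
  by rewrite -mxevalE U0.
rewrite exprSr -IHk -[_ * _]/(_ *m _) -scalemxAl coefmx_recursion //.
by rewrite scalerA -natrM factS mulnC.
Qed.

(** As [U] is polynomial, N^k = k! U_k vanishes for large k; the dimension lowers the exponent to
    3. *)
Lemma nilpotent_N : N ^+ 3 = 0.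
Proof.
have [m szU] := size_mx_bound U; apply: (@nilpotent_mx_exp _ _ _ m).
rewrite -coefmx_powers; apply/matrixP => i j.
by rewrite !mxE nth_default ?mulr0.
Qed.

Lemma unipotent_exp b :
  mxeval U b = 1%:M + b *: N + (b ^+ 2 / 2) *: (N *m N).
Proof.
have Uk k : (2 < k)%N -> coefmx U k = 0.
  move=> k2; apply/eqP; have /eqP : k`!%:R *: coefmx U k = 0.
    by rewrite coefmx_powers -(subnKC k2) exprD nilpotent_N mul0r.
  rewrite scaler_eq0 => /orP[|//]; move: (fact_gt0 k); case: k`! => // f _.
  by rewrite (negPf (natK_neq0 f)).
have U2 : coefmx U 2 = 2^-1 *: (N *m N).
  have := coefmx_powers 2; rewrite -[N ^+ 2]/(N *m N) => <-.
  by rewrite scalerA mulVf ?scale1r // (natK_neq0 1).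
have Uc0 : coefmx U 0 = 1%:M.
  by have := coefmx_powers 0; rewrite fact0 scale1r expr0.
have szU i j : (size (U i j) <= 3)%N.
  apply/leq_sizeP => k k2; have /matrixP/(_ i j) := Uk k k2.
  by rewrite !mxE.
rewrite (mxeval_coefmx _ szU) !big_ord_recl big_ord0 /= addr0 addrA.
by rewrite expr0 scale1r Uc0 U2 scalerA expr1.
Qed.

Lemma unipotent_mulv b (w : 'cV[K]_3) :
  mxeval U b *m w = w + b *: (N *m w) + (b ^+ 2 / 2) *: (N *m (N *m w)).
Proof. by rewrite unipotent_exp !mulmxDl mul1mx -!scalemxAl mulmxA. Qed.

(** This is the coefficient of b in [TU]; it says that [N] raises weights by [d]. *)
Lemma weight_shift t : t != 0 -> mxeval T t *m N = t ^ d *: (N *m mxeval T t).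
Proof.
move=> t0; rewrite /N -coefmxMl -coefmxMr.
have -> : map_mx polyC (mxeval T t) *m U =
    map_mx (comp_poly ((t ^ d)%:P * 'X)) (U *m map_mx polyC (mxeval T t)).
  apply: mxeval_inj_off0 => b _.
  rewrite mxevalM mxeval_const mxeval_comp hornerM hornerC hornerX.
  by rewrite mxevalM mxeval_const TU.
by rewrite coefmx_comp expr1.
Qed.

Definition weight_vector (m : nat) (v : 'cV[K]_3) :=
  forall t, t != 0 -> mxeval T t *m v = t ^+ m *: v.

Lemma weight_vector_coefmx k v : weight_vector k (coefmx T k *m v).
Proof. by move=> t t0; rewrite mulmxA weight_coefmx // -scalemxAl. Qed.

Lemma weight_vector_ex (A : 'M[K]_3) : A != 0 ->
  exists m v, weight_vector m v /\ A *m v != 0.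
Proof.
move=> A0; have [j Aj] : exists j, A *m delta_mx j (0 : 'I_1) != 0.
  apply/existsP; apply: contraNT A0 => /existsPn A0; apply/eqP/matrixP => i j.
  by have /negPn/eqP/matrixP/(_ i 0) := A0 j; rewrite -colE !mxE.
have [M Dv] := weight_decomposition T1 (delta_mx j (0 : 'I_1)).
have [k Ak] : exists k : 'I_M, A *m (coefmx T k *m delta_mx j (0 : 'I_1)) != 0.
  apply/existsP; apply: contraNT Aj => /existsPn A00.
  by rewrite Dv mulmx_sumr big1 // => k _; apply/eqP/negPn.
by exists k, (coefmx T k *m delta_mx j 0); split=> //; apply: weight_vector_coefmx.
Qed.

(** In dimension 3, N^2 = 0 forces rank at most 1, so ker N contains a vector off the line of [v].
    Its weight components stay in ker N, which is stable under the torus, and one of them is off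
    that line. *)
Lemma kernel_weight_vector (v : 'cV[K]_3) : N *m N = 0 ->
  exists k u, [/\ weight_vector k u, N *m u = 0 & forall c, u != c *: v].
Proof.
move=> N2; have [u0 [Nu0 u0v]] : exists u0 : 'cV_3, N *m u0 = 0 /\ ~~ (u0^T <= v^T)%MS.
  have /row_subPn [i ri] : ~~ (kermx N^T <= v^T)%MS.
    apply: contraL (mulmx0_rank_max N2) => /mxrankS.
    rewrite mxrank_ker mxrank_tr => rk; rewrite -ltnNge.
    have := leq_trans rk (rank_leq_row _); rewrite leq_subLR.
    by case: (\rank N) => [|[|r]] // _; rewrite !addSn !addnS.
  exists (row i (kermx N^T))^T; rewrite trmxK; split=> //.
  by apply: trmx_inj; rewrite trmx_mul trmxK trmx0 -row_mul mulmx_ker row0.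
have [M Du] := weight_decomposition T1 u0.
have [k ku] : exists k : 'I_M, ~~ ((coefmx T k *m u0)^T <= v^T)%MS.
  apply/existsP; apply: contraNT u0v => /existsPn kv.
  rewrite Du raddf_sum /=; apply: summx_sub => k _; exact/negPn.
exists k, (coefmx T k *m u0); split; first exact: weight_vector_coefmx.
  rewrite mulmxA -coefmxMl; apply: coefmx_mulv => t t0.
  rewrite mxevalM mxeval_const; apply: (scalerI (expfz_neq0 d t0)).
  by rewrite scalemxAl -weight_shift // -mulmxA Nu0 mulmx0 scaler0.
move=> c; apply: contraNneq ku => ->.
by rewrite linearZ scalemx_sub.
Qed.

Lemma weight_N k v : weight_vector k v ->
  forall t, t != 0 -> mxeval T t *m (N *m v) = (t ^+ k * t ^ d) *: (N *m v).
Proof.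
move=> wv t t0; rewrite mulmxA weight_shift // -scalemxAl -mulmxA wv //.
by rewrite -scalemxAr scalerA mulrC.
Qed.

(** The columns of [P] are the new basis; the factor [t ^+ m], invisible on the plane, brings the
    weight of the last basis vector to 0. *)
Definition rho_like m (P : 'M[K]_3) := forall b t, t != 0 ->
  mxeval U b *m mxeval T t *m P = t ^+ m *: (P *m mx3
    [:: [:: t ^ (2 * d); b * t ^ d; b ^+ 2 / 2]; [:: 0; t ^ d; b]; [:: 0; 0; 1]]).

Definition tau_like m (k : int) (P : 'M[K]_3) := forall b t, t != 0 ->
  mxeval U b *m mxeval T t *m P = t ^+ m *: (P *m mx3
    [:: [:: t ^ k; 0; 0]; [:: 0; t ^ d; b]; [:: 0; 0; 1]]).

(** For a weight vector v with N^2 v <> 0 the basis is N^2 v, N v, v, of weights m + 2d, m + d,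
    m. *)
Lemma rho_basis : N *m N != 0 -> exists m P, P \in unitmx /\ rho_like m P.
Proof.
move=> /weight_vector_ex [m [v [wv NNv]]].
have N3 : N *m (N *m (N *m v)) = 0.
  have N3mx : N *m (N *m N) = 0 by exact: nilpotent_N.
  by rewrite !mulmxA -[N *m N *m N]mulmxA N3mx mul0mx.
exists m, (cols3 (N *m (N *m v)) (N *m v) v); split.
  apply: cols3_unit => x y z xyz.
  rewrite -mulmxA in NNv.
  have z0 : z = 0.
    apply/eqP; have /eqP := congr1 (fun w => N *m (N *m w)) xyz.
    rewrite !mulmxDr -!scalemxAr N3 !mulmx0 !scaler0 !add0r scaler_eq0.
    by rewrite (negPf NNv) orbF.
  have y0 : y = 0.
    apply/eqP; have /eqP := congr1 (mulmx N) xyz.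
    rewrite z0 scale0r addr0 mulmxDr -!scalemxAr N3 mulmx0 scaler0 add0r scaler_eq0.
    by rewrite (negPf NNv) orbF.
  split=> //; apply/eqP; move/eqP: xyz.
  by rewrite y0 z0 !scale0r !addr0 scaler_eq0 (negPf NNv) orbF.
move=> b t t0; rewrite cols3_mx3 scale_cols3 -mulmxA !mulmx_cols3.
have wNv := weight_N wv t0.
have wNNv : mxeval T t *m (N *m (N *m v)) = (t ^+ m * t ^ d * t ^ d) *: (N *m (N *m v)).
  by rewrite mulmxA weight_shift // -scalemxAl -mulmxA wNv -scalemxAr scalerA mulrC.
rewrite wNNv wNv wv // -!scalemxAr !unipotent_mulv N3 mulmx0.
have -> : t ^ (2 * d) = t ^ d * t ^ d by rewrite -expfzDr //; congr (_ ^ _); ring.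
move: (N *m (N *m v)) (N *m v) (t ^ d) => v2 v1 td.
by congr cols3; apply/matrixP => i j; rewrite !mxE; ring.
Qed.

(** The basis is u, N v, v, with v a weight vector outside ker N and u one inside ker N, off the
    line of N v. The exponent of the model is the weight of u minus that of v. *)
Lemma tau_basis : N != 0 -> N *m N = 0 -> exists m k P, P \in unitmx /\ tau_like m k P.
Proof.
move=> /weight_vector_ex [m [v [wv Nv]]] N2.
have [k [u [wu Nu uNv]]] := kernel_weight_vector (N *m v) N2.
have NNv : N *m (N *m v) = 0 by rewrite mulmxA N2 mul0mx.
exists m, (k%:Z - m%:Z), (cols3 u (N *m v) v); split.
  apply: cols3_unit => x y z xyz.
  have z0 : z = 0.
    apply/eqP; have /eqP := congr1 (mulmx N) xyz.
    rewrite !mulmxDr -!scalemxAr Nu NNv mulmx0 !scaler0 !add0r scaler_eq0.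
    by rewrite (negPf Nv) orbF.
  rewrite z0 scale0r addr0 in xyz.
  have x0 : x = 0.
    apply/eqP; apply: contraT => x0; have /eqP[] := uNv (- (y / x)).
    apply: (scalerI x0); rewrite scalerA mulrN mulrCA mulfV // mulr1 scaleNr.
    by apply/eqP; rewrite -addr_eq0 xyz.
  split=> //; apply/eqP; move/eqP: xyz.
  by rewrite x0 scale0r add0r scaler_eq0 (negPf Nv) orbF.
move=> b t t0; rewrite cols3_mx3 scale_cols3 -mulmxA !mulmx_cols3.
rewrite (weight_N wv t0) wv // wu // -!scalemxAr !unipotent_mulv NNv Nu mulmx0.
have -> : t ^+ k = t ^+ m * t ^ (k%:Z - m%:Z).
  by rewrite !exprnP -expfzDr // addrCA subrr addr0.
move: (N *m v) (t ^ d) => v1 td.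
by congr cols3; apply/matrixP => i j; rewrite !mxE; ring.
Qed.

End WeightBasis.

(** * Projective transformations given by matrices *)

Section MatrixActions.
Variable K : fieldType.
Implicit Types (A B Q : 'M[K]_3) (p : P2 K).

Lemma mx_act_eq A B (uA : A \in unitmx) (uB : B \in unitmx) p :
  A = B -> mx_act uA p = mx_act uB p.
Proof. by move=> AB; apply: val_inj; rewrite /= AB. Qed.

Lemma mx_act_scalar A (uA : A \in unitmx) c p : A = c%:M -> mx_act uA p = p.
Proof.
move=> Ac; have [v pv] := hcoord_ex p; apply: (hcoord_inj (v := A *m v)).
  exact: hcoord_mx_act.
rewrite Ac mul_scalar_mx hcoordZ //; apply: contraTneq uA => c0.
by rewrite Ac c0 -scalemx1 scale0r unitmxE det0 unitr0.
Qed.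

Lemma mx_actK A (uA : A \in unitmx) (uV : invmx A \in unitmx) :
  cancel (mx_act uA) (mx_act uV).
Proof.
move=> p; have [v pv] := hcoord_ex p; apply: (hcoord_inj (v := v)) => //.
by rewrite -[v](mulKmx uA); do 2!apply: hcoord_mx_act.
Qed.

Lemma mx_actVK A (uA : A \in unitmx) (uV : invmx A \in unitmx) :
  cancel (mx_act uV) (mx_act uA).
Proof.
move=> p; have [v pv] := hcoord_ex p; apply: (hcoord_inj (v := v)) => //.
by rewrite -[v](mulKVmx uA); do 2!apply: hcoord_mx_act.
Qed.

Definition linear_form (r : 'I_3 -> K) : {mpoly K[3]} := \sum_i r i *: 'X_i.

Lemma linear_form_homog r : linear_form r \is 1.-homog.
Proof. by apply: rpred_sum => i _; apply: rpredZ; rewrite dhomogX /= mdeg1. Qed.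

Lemma eval_linear_form r v : eval3 (linear_form r) v = \sum_i r i * v i 0.
Proof.
rewrite /eval3 /linear_form raddf_sum /=; apply: eq_bigr => i _.
by rewrite mevalZ mevalXU.
Qed.

Lemma mx_act_regular A (uA : A \in unitmx) : regular_endoP2 (mx_act uA).
Proof.
move=> p; exists 1%N, (fun i => linear_form (A i)).
have AE v : evalv (fun i => linear_form (A i)) v = A *m v.
  by apply/matrixP => i j; rewrite !mxE eval_linear_form ord1.
split=> [i||q w qw _]; first exact: linear_form_homog.
  have [v pv] := hcoord_ex p; exists v; rewrite // AE.
  by case/andP: (hcoord_mx_act uA pv).
by rewrite AE; apply: hcoord_mx_act.
Qed.

Lemma mx_act_inj A (uA : A \in unitmx) : injective (mx_act uA).
Proof.
have uV : invmx A \in unitmx by rewrite unitmx_inv.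
exact: can_inj (mx_actK uA uV).
Qed.

Lemma mx3_id : mx3 [:: [:: 1; 0; 0]; [:: 0; 1; 0]; [:: 0; 0; 1]] = 1%:M :> 'M[K]_3.
Proof. by apply/matrixP => -[[|[|[|i]]] ?] [[|[|[|j]]] ?] //=; rewrite !mxE. Qed.

Lemma mx_act_aut A (uA : A \in unitmx) : algebraic_autP2 (mx_act uA).
Proof.
have uV : invmx A \in unitmx by rewrite unitmx_inv.
by exists (mx_act uV); split; [apply: mx_actK|apply: mx_actVK| |]; apply: mx_act_regular.
Qed.

End MatrixActions.

Section GenericTransitivity.
Variables (K : fieldType) (d : int).
Local Notation G := (G K d).
Variable a : G -> P2 K -> P2 K.

(** For k = 0 both x and z are invariant, so each orbit is contained in a line and misses a nonempty
    open set. *)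
Lemma tau0_not_generically_transitive (Q : 'M[K]_3) (uQ : Q \in unitmx) :
    (forall g p, mx_act uQ (a g p) = tau 0 g (mx_act uQ p)) ->
  ~ generically_transitive a.
Proof.
move=> aQ [U [_ denseU transU]].
pose V (r : 'rV[K]_3) p := exists2 v, hcoord p v & (r *m v) 0 0 != 0.
have openV r : zariski_open (V r).
  exists (eq (linear_form (r 0))); split=> [_ <-|p].
    by exists 1%N; apply: linear_form_homog.
  have rE v : eval3 (linear_form (r 0)) v = (r *m v) 0 0.
    by rewrite eval_linear_form mxE.
  split=> [[v pv rv]|[_ [v [<- pv rv]]]]; last by exists v; rewrite // -rE.
  by exists (linear_form (r 0)), v; rewrite rE.
have V_ex (r : 'rV[K]_3) : r != 0 -> exists p, V r p.
  case/rV0Pn => i ri; have [|p pi] := @point_ex K (delta_mx i 0).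
    by apply/negP => /eqP/matrixP/(_ i 0)/eqP; rewrite !mxE !eqxx oner_eq0.
  by exists p, (delta_mx i 0); rewrite // -colE mxE.
have rowQ i : row i Q != 0.
  apply/negP => /eqP Qi; have := mulmxV uQ => /(congr1 (row i)).
  by rewrite row_mul Qi mul0mx => /matrixP/(_ 0 i)/eqP; rewrite !mxE eqxx eq_sym oner_eq0.
have [p [Up _]] := denseU (V (row 0 Q)) (openV _) (V_ex _ (rowQ 0)).
have [v pv] := hcoord_ex p.
pose i2 : 'I_3 := inord 2; have [w Dw] : exists w, w = Q *m v by exists (Q *m v).
have aw g v' : hcoord (a g p) v' -> exists c,
    (Q *m v') 0 0 = c * w 0 0 /\ (Q *m v') i2 0 = c * w i2 0.
  move=> /(hcoord_mx_act uQ); rewrite aQ => av'.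
  have := hcoord_mx_act (tau_unit 0 g) (hcoord_mx_act uQ pv).
  move=> /hcoord_scale/(_ av') [c _ ->]; exists c; rewrite -Dw.
  split; rewrite mxE; congr (_ * _); rewrite !mxE !big_ord_recl big_ord0 !mxE /=.
    by rewrite expr0z mul1r !mul0r !addr0.
  rewrite inordK //= !mul0r !add0r mul1r addr0; congr (w _ _); apply: val_inj.
  by rewrite /= inordK.
(* The equation z(p) x = x(p) z of a line containing the orbit, pulled back by [Q]. If it is zero,
   then x(p) = 0 and the line x = 0 serves instead. *)
pose s : 'rV[K]_3 := w i2 0 *: row 0 Q - w 0 0 *: row i2 Q.
have rowE i (v' : 'cV_3) : (row i Q *m v') 0 0 = (Q *m v') i 0.
  by rewrite -row_mul [LHS]mxE.
have [r r0 Vr] : exists2 r : 'rV_3, r != 0 & forall g, ~ V r (a g p).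
  have [s0|s0] := eqVneq s 0; [exists (row 0 Q) | exists s] => // g [v' /aw [c [E0 E2]]].
    rewrite rowE E0; suff -> : w 0 0 = 0 by rewrite mulr0 eqxx.
    apply/eqP; rewrite -oppr_eq0; apply/eqP.
    have := congr1 (fun x => (x *m invmx Q) 0 i2) s0.
    rewrite mulmxBl -!scalemxAl -!row_mul mulmxV // mul0mx !mxE eqxx.
    by rewrite -val_eqE /= inordK // mulr0 add0r mulr1.
  rewrite mulmxBl -!scalemxAl mxE [X in X + _]mxE [X in _ + X]mxE [X in - X]mxE !rowE.
  by rewrite E0 E2 [X in X != 0](_ : _ = 0) ?eqxx //; ring.
have [q [Uq Vq]] := denseU (V r) (openV r) (V_ex r r0).
by have [g gpq] := transU p q Up Uq; apply: (Vr g); rewrite gpq.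
Qed.

End GenericTransitivity.

(** Equivalence through the identity automorphism of the group, which is what a change of basis
    provides. *)
Definition conjugate_actions (K : fieldType) (d : int) (a1 a2 : G K d -> P2 K -> P2 K) :=
  exists2 j : P2 K -> P2 K, algebraic_autP2 j & forall g p, j (a1 g p) = a2 g (j p).

(** * Existence of the normal form *)

Section Equivalences.
Variables (K : closedFieldType) (d : int).
Hypothesis charK0 : [pchar K] =i pred0.
Local Notation G := (G K d).
Variable a : G -> P2 K -> P2 K.

Lemma acts_by_conj (R : G -> 'M[K]_3) (uR : forall g, R g \in unitmx)
    (M : G -> 'M[K]_3) (P : 'M[K]_3) (uQ : invmx P \in unitmx) (c : G -> K) :
    P \in unitmx -> (forall g, acts_by a g (M g)) ->
    (forall g, c g != 0) -> (forall g, M g *m P = c g *: (P *m R g)) ->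
  forall g p, mx_act uQ (a g p) = mx_act (uR g) (mx_act uQ p).
Proof.
move=> uP aM c0 MP g p; have [v pv] := hcoord_ex p.
apply: (hcoord_inj (v := invmx P *m (M g *m v))).
  by apply: hcoord_mx_act; case: (aM g) => _; apply.
have -> : invmx P *m (M g *m v) = c g *: (R g *m (invmx P *m v)).
  rewrite -[M g](mulmxK uP) MP -!scalemxAl -scalemxAr -!mulmxA.
  by rewrite mulKmx.
by rewrite hcoordZ //; do 2!apply: hcoord_mx_act.
Qed.

Hypothesis faithful_a : faithful_action a.

Lemma faithful_scalar g (M : 'M[K]_3) c : acts_by a g M -> M = c%:M -> g = 1%g.
Proof.
move=> [uM aM] Mc; apply: faithful_a => p; have [v pv] := hcoord_ex p.
apply: (hcoord_inj (aM p v pv)); rewrite Mc mul_scalar_mx hcoordZ //.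
by apply: contraTneq uM => c0; rewrite Mc c0 -scalemx1 scale0r unitmxE det0 unitr0.
Qed.

(** A root of 1 + X + ... + X^(n-1) is taken; at 1 this polynomial has the value n, nonzero in
    characteristic 0. *)
Lemma root_of_unity_neq1 n : (1 < n)%N -> exists2 z : K, z ^+ n = 1 & z != 1.
Proof.
move=> n1; have /closed_rootP [z] : size (\poly_(i < n) (1 : K)) != 1%N.
  by rewrite size_poly_eq ?oner_neq0 // gtn_eqF.
rewrite /root horner_poly => /eqP z0; exists z.
  apply/eqP; rewrite -subr_eq0 subrX1; apply/eqP.
  rewrite [X in _ * X](_ : _ = 0) ?mulr0 // -[RHS]z0.
  by apply: eq_bigr => i _; rewrite mul1r.
apply/negP => /eqP z1; move: z0; rewrite z1.
under eq_bigr => i _ do rewrite expr1n mulr1.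
rewrite sumr_const card_ord; case: n n1 {z z1} => // n _ /eqP.
by rewrite (negPf (natK_neq0 charK0 n)).
Qed.

Lemma exprz_absz_eq1 (z : K) (k : int) : z ^+ `|k| = 1 -> z ^ k = 1.
Proof.
by case: k => k //= zk; rewrite NegzE -exprnN [z ^+ k.+1]zk invr1.
Qed.

Lemma exprz_dvd_eq1 (z : K) n (k : int) : z ^+ n = 1 -> (n %| `|k|)%N -> z ^ k = 1.
Proof.
by move=> zn /dvdnP[q kq]; apply: exprz_absz_eq1; rewrite kq mulnC exprM zn expr1n.
Qed.

Hypothesis transitive_a : generically_transitive a.
Hypothesis alg_a : algebraic_action a.

Lemma classification :
  (exists k : int, [/\ k != 0, gcdn `|k| `|d| = 1%N & conjugate_actions a (tau k)])
  \/ d != 0 /\ conjugate_actions a (@rho K d).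
Proof.
have [U [T [aUT [U0 UD] [T1 TM] TU]]] := representation_lift alg_a.
have aM g : acts_by a g (mxeval U (gb g) *m mxeval T (gt g)).
  by have := aUT (gb g) (gt g) (gt_neq0 g); rewrite (_ : mkG _ _ _ = g) //; apply: eqG.
(* With N = 0 the element (1, 1) would act trivially, against faithfulness. *)
have N0 : coefmx U 1 != 0.
  apply: contraTneq (oner_neq0 K) => N0; rewrite negbK; apply/eqP.
  suff : mkG d 1 (oner_neq0 K) = 1%g by move/(congr1 (@gb K d)).
  apply: (@faithful_scalar _ _ 1 (aUT 1 1 (oner_neq0 K))).
  by rewrite (unipotent_exp charK0 U0 UD) N0 mulmx0 !scaler0 !addr0 T1 mulmx1.
have [N2|N2] := eqVneq (coefmx U 1 *m coefmx U 1) 0; last first.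
  right; have [m [P [uP rhoP]]] := rho_basis charK0 U0 UD T1 TM TU N2.
  have uQ : invmx P \in unitmx by rewrite unitmx_inv.
  have conj := @acts_by_conj _ (@rho_unit K d) _ P uQ (fun g => gt g ^+ m) uP aM.
  have {}conj : forall g p, mx_act uQ (a g p) = rho g (mx_act uQ p).
    by apply: conj => g; [apply/expf_neq0/gt_neq0 | apply/rhoP/gt_neq0].
  split; last by exists (mx_act uQ) => //; apply: mx_act_aut.
  (* For d = 0 the torus acts trivially through [rho]; the element (0, 2) then contradicts
     faithfulness, as 2 is neither 0 nor 1. *)
  apply/negP => /eqP d0; have two0 : (2 : K) != 0 := natK_neq0 charK0 1.
  suff /(congr1 (@gt K d))/eqP : mkG d 0 two0 = 1%g.
    by rewrite -subr_eq0 /gt /= -[2]/(1 + 1) addrK oner_eq0.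
apply: faithful_a => p; apply: (mx_act_inj (uA := uQ)); rewrite conj.
  apply: (mx_act_scalar _ (c := 1)); rewrite -mx3_id /rho_mx /gb /gt /=.
  by rewrite d0 mulr0 !expr0z mul0r expr0n mul0r.
left; have [m [k [P [uP tauP]]]] := tau_basis charK0 U0 UD T1 TM TU N0 N2.
have uQ : invmx P \in unitmx by rewrite unitmx_inv.
have conj := @acts_by_conj _ (@tau_unit K d k) _ P uQ (fun g => gt g ^+ m) uP aM.
have {}conj : forall g p, mx_act uQ (a g p) = tau k g (mx_act uQ p).
  by apply: conj => g; [apply/expf_neq0/gt_neq0 | apply/tauP/gt_neq0].
have k0 : k != 0.
  apply/negP => /eqP k0; rewrite k0 in conj.
  exact: tau0_not_generically_transitive conj transitive_a.
exists k; split=> //; last first.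
  by exists (mx_act uQ) => //; apply: mx_act_aut.
have e0 : (0 < gcdn `|k| `|d|)%N by rewrite gcdn_gt0 absz_gt0 k0.
apply/eqP; rewrite eqn_leq e0 andbT leqNgt; apply/negP => e1.
(* A root of unity [z] <> 1 with z^k = z^d = 1 makes (0, z) act trivially. *)
have [z ze z1] := root_of_unity_neq1 e1.
have z0 : z != 0.
  apply: contraTneq (oner_neq0 K) => z0; rewrite negbK eq_sym -ze z0.
  by rewrite expr0n gtn_eqF.
suff /(congr1 (@gt K d))/eqP : mkG d 0 z0 = 1%g by rewrite (negPf z1).
apply: faithful_a => p; apply: (mx_act_inj (uA := uQ)); rewrite conj.
apply: (mx_act_scalar _ (c := 1)); rewrite -mx3_id /tau_mx /gb /gt /=.
by rewrite !(exprz_dvd_eq1 ze) // ?dvdn_gcdl ?dvdn_gcdr.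
Qed.

End Equivalences.

Section ConjugateEquivalent.
Variables (K : fieldType) (d : int).
Local Notation G := (G K d).

Lemma id_algebraic_autG : algebraic_autG (@id G).
Proof.
split=> //; exists id; suff reg : regular_endoG (@id G) by split.
split; [exists 'X_0, 0%N | exists 'X_1, 0%N] => g;
  by rewrite mevalXU expr0 divr1 /gcoord (tnth_nth 0).
Qed.

Lemma conjugate_equivalent (a1 a2 : G -> P2 K -> P2 K) :
  conjugate_actions a1 a2 -> equivalent_actions a1 a2.
Proof.
by move=> [j autj a12]; exists id, j; split=> //; apply: id_algebraic_autG.
Qed.

End ConjugateEquivalent.

(** For d = 0 the group is a direct product, so inverting t is an automorphism; it exchanges k and
    -k. *)
Lemma conjugate_tau_opp (K : fieldType) (a : G K 0 -> P2 K -> P2 K) k :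
  conjugate_actions a (tau (- k)) -> equivalent_actions a (tau k).
Proof.
move=> [j autj aj].
pose inv_t (g : G K 0) : G K 0 := mkG 0 (gb g) (invr_neq0 (gt_neq0 g)).
have inv_tK : cancel inv_t inv_t by move=> g; apply: eqG; rewrite /gb /gt //= invrK.
have reg_inv_t : regular_endoG inv_t.
  split; [exists 'X_0, 0%N | exists 1, 1%N] => g.
    by rewrite mevalXU expr0 divr1 /gcoord (tnth_nth 0).
  by rewrite meval1 expr1 div1r.
exists inv_t, j; split=> // [|g p].
  split; last by exists inv_t.
  by move=> g h; apply: eqG; rewrite /gb /gt /= ?invfM // !expr0z.
rewrite aj; apply: mx_act_eq; rewrite /tau_mx /gb /gt /= !expr0z.
by rewrite exprz_inv.
Qed.

(** * Uniqueness *)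

Section AbstractInvariants.
Variables (K : closedFieldType) (d : int).
Hypothesis charK0 : [pchar K] =i pred0.
Hypothesis d0 : d != 0.
Local Notation G := (G K d).

(** In characteristic 0 the polynomial X^m - 1 is separable for m > 0, so it has m distinct roots,
    all of them roots of X^n - 1. *)
Lemma roots_of_unity_leq m n : (0 < n)%N ->
  (forall t : K, t ^+ m = 1 -> t ^+ n = 1) -> (m <= n)%N.
Proof.
case: m => // m n0 mn; have [r Dr] := closed_field_poly_normal ('X^(m.+1) - 1 : {poly K}).
rewrite (monicP (monicXnsubC 1 (ltn0Sn m))) scale1r in Dr.
have Xn0 : 'X^n - 1 != 0 :> {poly K} by apply: monic_neq0; apply: monicXnsubC.
have uniq_r : uniq r.
  by rewrite -separable_prod_XsubC -Dr separable_Xn_sub_1 // natK_neq0.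
have rootn : all (root ('X^n - 1)) r.
  apply/allP => t tr; have : root ('X^(m.+1) - 1) t by rewrite Dr root_prod_XsubC.
  by rewrite /root !hornerE !subr_eq0 => /eqP/mn ->.
have := max_poly_roots Xn0 rootn uniq_r.
have -> : size r = m.+1.
  by have := congr1 (size : {poly K} -> nat) Dr; rewrite size_prod_XsubC size_XnsubC // => -[].
by rewrite size_XnsubC // ltnS.
Qed.

Lemma exprz_absz (t : K) (k : int) : t ^ k = 1 <-> t ^+ `|k| = 1.
Proof.
split=> [|/exprz_absz_eq1 //]; case: k => k //=.
by rewrite NegzE -exprnN => /(canRL invrK) ->; rewrite invr1.
Qed.

(** Each inclusion bounds one absolute value by the other, except for the exponent 0, which imposes
    no condition on t and is recognized through [exprz_all1]. *)
Lemma roots_of_unity_inj (k l : int) :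
  (forall t : K, t != 0 -> (t ^ k = 1 <-> t ^ l = 1)) -> `|k|%N = `|l|%N.
Proof.
have half (m n : int) : (forall t : K, t != 0 -> t ^ m = 1 -> t ^ n = 1) ->
    (`|m| <= `|n|)%N \/ n = 0.
  move=> mn; have [->|n0] := eqVneq n 0; [by right | left].
  apply: roots_of_unity_leq => [|t tm]; first by rewrite absz_gt0.
  have [t0|t0] := eqVneq t 0; last by apply/exprz_absz/mn => //; apply/exprz_absz.
  move: tm; rewrite t0 expr0n; case: eqP => [m0 _|_ /eqP]; last by rewrite eq_sym oner_eq0.
  suff n00 : n = 0 by rewrite n00 in n0.
  have m00 : m = 0 by apply/eqP; rewrite -absz_eq0 m0.
  by apply: (@exprz_all1 K) => s s0; apply: mn; rewrite // m00 expr0z.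
move=> kl; have [|l0] := half k l (fun t t0 => proj1 (kl t t0)); last first.
  suff -> : k = 0 by rewrite l0.
  by apply: (@exprz_all1 K) => s s0; apply/kl; rewrite // l0 expr0z.
have [|k0] := half l k (fun t t0 => proj2 (kl t t0)); last first.
  suff -> : l = 0 by rewrite k0.
  by apply: (@exprz_all1 K) => s s0; apply/kl; rewrite // k0 expr0z.
by move=> lk kl'; apply/eqP; rewrite eqn_leq kl' lk.
Qed.

Lemma gtM (g h : G) : gt (g * h)%g = gt g * gt h. Proof. by []. Qed.

Lemma gt_additive b : gt (additive_elt d b : G) = 1. Proof. by []. Qed.

Section GroupAutomorphism.
Variables (alpha beta : G -> G).
Hypothesis alphaM : {morph alpha : g h / (g * h)%g}.
Hypotheses (alphaK : cancel alpha beta) (betaK : cancel beta alpha).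

Lemma beta_morph : {morph beta : g h / (g * h)%g}.
Proof. by move=> g h; apply: (can_inj alphaK); rewrite alphaM !betaK. Qed.

(* For d <> 0 the elements (b, 1) are commutators. *)
Lemma gt_image_additive b : gt (alpha (additive_elt d b)) = 1.
Proof.
have [t [t0 td]] : exists t : K, t != 0 /\ t ^ d != 1.
  apply: NNPP => not_ex; case/eqP: d0; apply: (@exprz_all1 K) => t t0.
  by apply/eqP; apply: contraT => td; case: not_ex; exists t.
have td1 : t ^ d - 1 != 0 by rewrite subr_eq0.
(* The value c = b / (t^d - 1) solves t^d c = b + c, so (b, 1) is the commutator of (0, t) and (c,
   1). *)
pose g : G := torus_elt d t0; pose h : G := additive_elt d (b / (t ^ d - 1)).
have gh : (g * h = additive_elt d b * (h * g))%g.
  apply: eqG; rewrite /gb /gt /= /gb /gt /= /gb /gt /= ?exp1rz; last by rewrite !(mulr1, mul1r).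
  by field.
have := congr1 (fun x => gt (alpha x)) gh; rewrite !alphaM !gtM => E.
apply: (mulIf (mulf_neq0 (gt_neq0 (alpha h)) (gt_neq0 (alpha g)))).
by rewrite -E mul1r mulrC.
Qed.

(** [g] and [h] differ by an element of G_a, whose image has t-coordinate 1; thus [alpha] induces a
    map on the quotient G_m. *)
Lemma gt_image (g h : G) : gt g = gt h -> gt (alpha g) = gt (alpha h).
Proof.
move=> gh; have -> : g = (additive_elt d (gb g - gb h) * h)%g.
  by apply: eqG; rewrite ?gtM ?gt_additive ?mul1r // {2}/gb /= gt_additive exp1rz mul1r subrK.
by rewrite alphaM gtM gt_image_additive mul1r.
Qed.

Lemma gt_image_power (g : G) n : exists h : G,
  gt h = gt g ^+ n /\ gt (alpha h) = gt (alpha g) ^+ n.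
Proof.
elim: n => [|n [h [gth gtah]]].
  exists (additive_elt d 0); split=> //.
  by rewrite gt_image_additive expr0.
by exists (g * h)%g; rewrite alphaM !gtM gth gtah !exprS.
Qed.

Lemma gt_image_root (g : G) (k : int) : gt g ^ k = 1 -> gt (alpha g) ^ k = 1.
Proof.
move/exprz_absz => gk; apply/exprz_absz; have [h [gth <-]] := gt_image_power g `|k|.
by rewrite -(gt_image_additive 0); apply: gt_image; rewrite gth gk.
Qed.

End GroupAutomorphism.
Lemma gt_preimage_root (alpha beta : G -> G) :
    {morph alpha : g h / (g * h)%g} -> cancel alpha beta -> cancel beta alpha ->
  forall (g : G) (k : int), gt (alpha g) ^ k = 1 -> gt g ^ k = 1.
Proof.
move=> alphaM alphaK betaK g k.
by move/(gt_image_root (beta_morph alphaM alphaK betaK)); rewrite alphaK.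
Qed.

Definition vec3 (x y z : K) : 'cV[K]_3 := \col_i [:: x; y; z]`_i.

Lemma vec3_ex (v : 'cV[K]_3) : exists x y z, v = vec3 x y z.
Proof.
exists (v 0 0), (v 1 0), (v (inord 2) 0).
apply/matrixP => -[[|[|[|i]]] //= lti] j; rewrite ord1 !mxE /=; congr (v _ _);
  by apply: val_inj; rewrite //= inordK.
Qed.

Lemma vec3_inj x y z x' y' z' : vec3 x y z = vec3 x' y' z' -> [/\ x = x', y = y' & z = z'].
Proof.
move=> /matrixP E; split.
- by move: (E 0 0); rewrite !mxE.
- by move: (E 1 0); rewrite !mxE.
- by move: (E (inord 2) 0); rewrite !mxE inordK.
Qed.

Lemma scale_vec3 c x y z : c *: vec3 x y z = vec3 (c * x) (c * y) (c * z).
Proof. by apply/matrixP => -[[|[|[|i]]] //= lti] j; rewrite !mxE. Qed.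

Lemma mx3_vec3 (x y z r s t u v w : K) :
  mx3 [:: [:: x; r; s]; [:: 0; y; t]; [:: 0; 0; z]] *m vec3 u v w =
  vec3 (x * u + r * v + s * w) (y * v + t * w) (z * w).
Proof.
apply/matrixP => -[[|[|[|i]]] //= lti] j; rewrite !mxE !big_ord_recl big_ord0 !mxE /=; ring.
Qed.

Lemma mx_act_fixed (A : 'M[K]_3) (uA : A \in unitmx) (p : P2 K) v : hcoord p v ->
  mx_act uA p = p <-> exists2 c, c != 0 & A *m v = c *: v.
Proof.
move=> pv; have Apv := hcoord_mx_act uA pv; split=> [Ap|[c c0 Av]].
  by rewrite Ap in Apv; apply: hcoord_scale pv Apv.
by apply: (hcoord_inj Apv); rewrite Av hcoordZ.
Qed.

Lemma tau_fixed k (g : G) p x y z : hcoord p (vec3 x y z) ->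
  tau k g p = p <-> exists2 c, c != 0 &
    [/\ gt g ^ k * x = c * x, gt g ^ d * y + gb g * z = c * y & z = c * z].
Proof.
move=> pv; rewrite mx_act_fixed; last exact: pv.
rewrite /tau_mx mx3_vec3 !mul0r !addr0 mul1r.
by split=> -[c c0 E]; exists c => //; move: E; rewrite scale_vec3;
  [move/vec3_inj | case=> -> -> <-].
Qed.

Lemma rho_fixed (g : G) p x y z : hcoord p (vec3 x y z) ->
  rho g p = p <-> exists2 c, c != 0 &
    [/\ gt g ^ (2 * d) * x + gb g * gt g ^ d * y + gb g ^+ 2 / 2 * z = c * x,
        gt g ^ d * y + gb g * z = c * y & z = c * z].
Proof.
move=> pv; rewrite mx_act_fixed; last exact: pv.
rewrite /rho_mx mx3_vec3 mul1r.
by split=> -[c c0 E]; exists c => //; move: E; rewrite scale_vec3;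
  [move/vec3_inj | case=> -> -> <-].
Qed.

Definition additive_fixed (a : G -> P2 K -> P2 K) p :=
  forall b, a (additive_elt d b) p = p.

Lemma tau_additive_fixed k p x y z : hcoord p (vec3 x y z) ->
  additive_fixed (@tau K d k) p <-> z = 0.
Proof.
move=> pv; split=> [fixp|z0 b].
  have /(tau_fixed _ _ pv) [c c0] := fixp 1.
  rewrite /gt /gb /= !exp1rz !mul1r => -[_ Ey Ez].
  apply/eqP; apply: contraT => z0.
  have c1 : c = 1 by apply: (mulIf z0); rewrite mul1r -Ez.
  by move/eqP: Ey; rewrite c1 mul1r -subr_eq0 addrAC subrr add0r (negPf z0).
apply/(tau_fixed _ _ pv); exists 1; rewrite ?oner_neq0 //.
by rewrite /gt /gb /= !exp1rz !mul1r z0 mulr0 addr0.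
Qed.

Lemma rho_additive_fixed p x y z : hcoord p (vec3 x y z) ->
  additive_fixed (@rho K d) p -> y = 0 /\ z = 0.
Proof.
move=> pv fixp; have /(rho_fixed _ pv) [c c0] := fixp 1.
rewrite /gt /gb /= !exp1rz !mul1r expr1n => -[Ex Ey Ez].
have z0 : z = 0.
  apply/eqP; apply: contraT => z0.
  have c1 : c = 1 by apply: (mulIf z0); rewrite mul1r -Ez.
  by move/eqP: Ey; rewrite c1 mul1r -subr_eq0 addrAC subrr add0r (negPf z0).
split=> //; apply/eqP; apply: contraT => y0.
have c1 : c = 1 by apply: (mulIf y0); rewrite mul1r -Ey z0 addr0.
by move/eqP: Ex; rewrite c1 z0 mulr0 addr0 mul1r -subr_eq0 addrAC subrr add0r (negPf y0).
Qed.

End AbstractInvariants.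

(** * Comparison of fixed points and stabilizers *)

Section Uniqueness.
Variables (K : closedFieldType) (d : int).
Hypothesis charK0 : [pchar K] =i pred0.
Hypothesis d0 : d != 0.
Local Notation G := (G K d).
Local Notation P2 := (P2 K).
Implicit Types (a : G -> P2 -> P2) (p : P2).

(** The abstract content of an equivalence, with both inverses named so that the relation can be
    read backwards. *)
Definition intertwines (alpha beta : G -> G) (j i : P2 -> P2) a1 a2 :=
  [/\ {morph alpha : g h / (g * h)%g}, cancel alpha beta, cancel beta alpha,
      cancel j i & cancel i j] /\ forall g p, j (a1 g p) = a2 (alpha g) (j p).

Lemma intertwines_sym alpha beta j i a1 a2 :
  intertwines alpha beta j i a1 a2 -> intertwines beta alpha i j a2 a1.
Proof.
move=> [[alphaM alphaK betaK jK iK] ja]; split.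
  by split=> //; apply: beta_morph alphaK betaK.
by move=> g p; apply: (can_inj jK); rewrite iK ja betaK iK.
Qed.

Lemma equivalent_intertwines a a1 a2 :
    equivalent_actions a a1 -> equivalent_actions a a2 ->
  exists alpha beta j i, intertwines alpha beta j i a1 a2.
Proof.
move=> [al1 [j1 [[al1M [be1 [al1K be1K _ _]]] [i1 [j1K i1K _ _]] ja1]]].
move=> [al2 [j2 [[al2M [be2 [al2K be2K _ _]]] [i2 [j2K i2K _ _]] ja2]]].
exists (al2 \o be1), (al1 \o be2), (j2 \o i1), (j1 \o i2); split.
  split; try exact: can_comp.
  by move=> g h /=; rewrite (beta_morph al1M al1K be1K) al2M.
move=> g p /=; rewrite -ja2; congr j2; apply: (can_inj j1K).
by rewrite i1K ja1 be1K i1K.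
Qed.

Section Intertwined.
Variables (alpha beta : G -> G) (j i : P2 -> P2) (a1 a2 : G -> P2 -> P2).
Hypothesis twa : intertwines alpha beta j i a1 a2.

Lemma fixed_image g p : a1 g p = p <-> a2 (alpha g) (j p) = j p.
Proof.
have [[_ _ _ jK _] ja] := twa; split=> [gp|]; first by rewrite -ja gp.
by rewrite -ja => /(can_inj jK).
Qed.

Lemma additive_fixed_image p : additive_fixed a1 p -> additive_fixed a2 (j p).
Proof.
have [[alphaM alphaK betaK _ _] ja] := twa; move=> fixp b.
have betaM := beta_morph alphaM alphaK betaK.
have Db : beta (additive_elt d b) = additive_elt d (gb (beta (additive_elt d b))).
  by apply: eqG => //; rewrite (gt_image_additive d0 betaM).
by rewrite -[additive_elt d b]betaK -ja Db fixp.
Qed.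

End Intertwined.

Lemma additive_fixed_preimage alpha beta j i a1 a2 p :
  intertwines alpha beta j i a1 a2 -> additive_fixed a2 (j p) -> additive_fixed a1 p.
Proof.
move=> tw /(additive_fixed_image (intertwines_sym tw)).
by case: tw => [[_ _ _ -> _] _].
Qed.

Lemma vec3_neq0 (x y z : K) : (x != 0) || ((y != 0) || (z != 0)) -> vec3 x y z != 0.
Proof.
move=> xyz; apply/eqP; rewrite (_ : 0 = vec3 0 0 0) => [/vec3_inj[x0 y0 z0]|].
  by rewrite x0 y0 z0 eqxx in xyz.
by apply/matrixP => -[[|[|[|l]]] //= ltl] m; rewrite !mxE.
Qed.

Lemma vec3_point (x y z : K) : (x != 0) || ((y != 0) || (z != 0)) ->
  exists p, hcoord p (vec3 x y z).
Proof. by move/vec3_neq0/point_ex. Qed.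

Lemma hcoord_vec3 p : exists x y z, hcoord p (vec3 x y z).
Proof.
by have [v pv] := hcoord_ex p; have [x [y [z Dv]]] := vec3_ex v; exists x, y, z; rewrite -Dv.
Qed.

(** Under [tau k] the stabilizer of p = (1 : 0 : 1) is given by b = 0, t^k = 1. The point j(p) has z
    <> 0 because p is not fixed by G_a; once x <> 0 is known as well, stabilizing j(p) entails t^l =
    1. *)
Lemma generic_stabilizer alpha beta j i k l : k != 0 ->
    intertwines alpha beta j i (tau k) (tau l) ->
  forall t : K, t != 0 -> t ^ k = 1 -> t ^ l = 1.
Proof.
move=> k0 tw; have [[alphaM alphaK betaK _ _] _] := tw.
have betaM := beta_morph alphaM alphaK betaK.
have [|p pv] := @vec3_point 1 0 1; first by rewrite oner_neq0.
have [x [y [z jpv]]] := hcoord_vec3 (j p).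
have z0 : z != 0.
  apply/negP => /eqP/(tau_additive_fixed d l jpv)/(additive_fixed_preimage tw).
  by move/(tau_additive_fixed d k pv)/eqP; rewrite oner_eq0.
(* If x = 0, each s in G_m lifts to the stabilizer of j(p) by solving s^d y + b z = y for b. The
   stabilizer of p would then project onto G_m too, giving r^k = 1 for all r. *)
have x0 : x != 0.
  apply: contraNneq k0 => x0; apply/eqP; apply: (@exprz_all1 K) => r r0.
  pose s := alpha (torus_elt d r0).
  pose h := mkG d (y * (1 - gt s ^ d) / z) (gt_neq0 s).
  have : tau l (alpha (beta h)) (j p) = j p.
    rewrite betaK; apply/(tau_fixed _ _ jpv); exists 1; rewrite ?oner_neq0 // x0 !mulr0 !mul1r.
    by split=> //; rewrite divfK //; ring.
  move/(fixed_image tw)/(tau_fixed _ _ pv) => [c _ [Er _ Ec]].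
  have -> : r = gt (beta h).
    by rewrite (@gt_image _ _ d0 _ betaM h s) // /s alphaK.
  by move: Ec Er; rewrite !mulr1 => <-.
move=> t t0 tk; have : tau k (torus_elt d t0) p = p.
  apply/(tau_fixed _ _ pv); exists 1; rewrite ?oner_neq0 // !mulr1 !mulr0 add0r.
  by split.
move/(fixed_image tw)/(tau_fixed _ _ jpv) => [c _ [Ex _ Ez]].
have c1 : c = 1 by apply: (mulIf z0); rewrite -Ez mul1r.
apply: (gt_preimage_root d0 alphaM alphaK betaK (g := torus_elt d t0)).
by apply: (mulIf x0); rewrite Ex c1.
Qed.

Lemma exprz_sub_eq1 (t : K) (k l : int) : t != 0 -> t ^ k = t ^ l <-> t ^ (k - l) = 1.
Proof.
move=> t0; rewrite -[k in t ^ k](subrK l) expfzDr //; split=> [|->]; last by rewrite mul1r.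
by rewrite -[RHS]mul1r => /mulIf -> //; apply: expfz_neq0.
Qed.

(** The stabilizer of p = (1 : 1 : 0) is t^k = t^d. If j(p) is (1 : 0 : 0) or (0 : 1 : 0), it is
    fixed by the whole group, hence so is p, and k = d. Otherwise stabilizing j(p) means t^l =
    t^d. *)
Lemma infinity_stabilizer alpha beta j i k l :
    intertwines alpha beta j i (tau k) (tau l) ->
  (forall t : K, t != 0 -> t ^ (k - d) = 1 <-> t ^ (l - d) = 1) \/ k = d.
Proof.
move=> tw; have [[alphaM alphaK betaK _ _] _] := tw.
have [|p pv] := @vec3_point 1 1 0; first by rewrite oner_neq0.
have fixp (g : G) : tau k g p = p <-> gt g ^ (k - d) = 1.
  have [kd dk] := exprz_sub_eq1 k d (gt_neq0 g).
  rewrite (tau_fixed _ _ pv).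
  split=> [[c _ []]|/dk E].
    by rewrite mulr0 !mulr1 addr0 => Ek Ed _; apply: kd; rewrite Ek Ed.
  exists (gt g ^ d); first exact/expfz_neq0/gt_neq0.
  by rewrite !mulr1 !mulr0 addr0.
have [x [y [z jpv]]] := hcoord_vec3 (j p).
have z0 : z = 0.
  apply/(tau_additive_fixed d l jpv); apply: (additive_fixed_image tw).
  by apply/(tau_additive_fixed d k pv).
rewrite z0 in jpv.
have [xy0|] := boolP ((x == 0) || (y == 0)).
  right; apply/eqP; rewrite -subr_eq0; apply/eqP; apply: (@exprz_all1 K) => t t0.
  apply/(fixp (torus_elt d t0))/(fixed_image tw)/(tau_fixed _ _ jpv).
  set s := gt _; have s0 : s != 0 := gt_neq0 _.
  rewrite mulr0 addr0; case/orP: xy0 => /eqP ->.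
    by exists (s ^ d); rewrite ?expfz_neq0 // !mulr0.
  by exists (s ^ l); rewrite ?expfz_neq0 // !mulr0.
rewrite negb_or => /andP[x0 y0]; left => t t0.
have fixjp (g : G) : tau l g (j p) = j p <-> gt g ^ (l - d) = 1.
  have [ld dl] := exprz_sub_eq1 l d (gt_neq0 g).
  rewrite (tau_fixed _ _ jpv).
  split=> [[c _ []]|/dl E].
    by rewrite mulr0 addr0 => /(mulIf x0) El /(mulIf y0) Ed _; apply: ld; rewrite El Ed.
  exists (gt g ^ d); first exact/expfz_neq0/gt_neq0.
  by rewrite !mulr0 addr0 E.
rewrite -(fixp (torus_elt d t0)) (fixed_image tw) fixjp.
split=> [|tl]; first exact: gt_preimage_root alphaM alphaK betaK _ _.
exact: (gt_image_root d0 alphaM (g := torus_elt d t0)).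
Qed.

Lemma tau_equivalent_uniq a k l : k != 0 -> l != 0 ->
  equivalent_actions a (tau k) -> equivalent_actions a (tau l) -> k = l.
Proof.
move=> k0 l0 ak al; have [alpha [beta [j [i tw]]]] := equivalent_intertwines ak al.
have tw' := intertwines_sym tw.
have abs_kl : `|k|%N = `|l|%N.
  apply: (@roots_of_unity_inj K) => // t t0.
  by split; [exact: (generic_stabilizer k0 tw) | exact: (generic_stabilizer l0 tw')].
have abs_kld : `|k - d|%N = `|l - d|%N.
  have roots_inj := @roots_of_unity_inj K charK0.
  have [/roots_inj //|kd] := infinity_stabilizer tw.
  by have [/roots_inj -> //|ld] := infinity_stabilizer tw'; rewrite kd ld.
by move: abs_kl abs_kld d0 k0 l0; lia.
Qed.

(** Under [tau k] both (1 : 0 : 0) and (0 : 1 : 0) are fixed by G_a, while under [rho] only (1 : 0 :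
    0) can be; so j would not be injective. *)
Lemma tau_rho_not_equivalent a k :
  equivalent_actions a (tau k) -> equivalent_actions a (@rho K d) -> False.
Proof.
move=> ak ar; have [alpha [beta [j [i tw]]]] := equivalent_intertwines ak ar.
have [[_ _ _ jK _] _] := tw.
have fixed_line x y p : hcoord p (vec3 x y 0) ->
    exists c, hcoord (j p) (vec3 c 0 0).
  move/(tau_additive_fixed d k)=> [_ /(_ erefl)/(additive_fixed_image tw) fixjp].
  have [x' [y' [z' jpv]]] := hcoord_vec3 (j p).
  by have [y0 z0] := rho_additive_fixed jpv fixjp; exists x'; rewrite y0 z0 in jpv.
have [|p pv] := @vec3_point 1 0 0; first by rewrite oner_neq0.
have [|q qv] := @vec3_point 0 1 0; first by rewrite oner_neq0 orbT.
have [c jpv] := fixed_line _ _ _ pv; have [e jqv] := fixed_line _ _ _ qv.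
have vec3_x0 (x : K) r : hcoord r (vec3 x 0 0) -> x != 0.
  case/andP => + _; apply: contraNneq => ->; apply/eqP/matrixP.
  by move=> -[[|[|[|l]]] //= ltl] m; rewrite !mxE.
have [c0 e0] := (vec3_x0 _ _ jpv, vec3_x0 _ _ jqv).
have pq : p = q.
  apply: (can_inj jK); apply: (hcoord_inj jpv).
  have -> : vec3 c 0 0 = (c / e) *: vec3 e 0 0 by rewrite scale_vec3 !mulr0 divfK.
  by rewrite hcoordZ // mulf_neq0 ?invr_eq0.
rewrite -pq in qv; have [f _] := hcoord_scale pv qv.
by rewrite scale_vec3 mulr0 => /vec3_inj[_ /eqP + _]; rewrite oner_eq0.
Qed.

End Uniqueness.

Theorem theorem12 (K : closedFieldType) (charK0 : [pchar K] =i pred0) :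
  (forall (d : int) (a : G K d -> P2 K -> P2 K),
     d != 0 ->
     algebraic_action a -> faithful_action a -> generically_transitive a ->
     let equiv_tau (k : int) :=
       [/\ k != 0, gcdn `|k| `|d| = 1%N & equivalent_actions a (tau k)] in
     let equiv_rho := equivalent_actions a (@rho K d) in
     ((exists! k : int, equiv_tau k) \/ equiv_rho) /\
     ~ ((exists k : int, equiv_tau k) /\ equiv_rho))
  /\
  (forall a : G K 0 -> P2 K -> P2 K,
     algebraic_action a -> faithful_action a -> generically_transitive a ->
     equivalent_actions a (tau 1)).
Proof.
split=> [d a d0 alg_a faith_a trans_a equiv_tau equiv_rho|a alg_a faith_a trans_a].
  split; last by move=> [[k [_ _ ak]] ar]; apply: tau_rho_not_equivalent ak ar.
  have [[k [k0 kd ak]]|[_ ar]] := classification charK0 faith_a trans_a alg_a.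
    left; exists k; split=> [|l [l0 _ al]].
      by split=> //; apply: conjugate_equivalent.
    exact: tau_equivalent_uniq (conjugate_equivalent ak) al.
  by right; apply: conjugate_equivalent.
have [[k [_ k1 ak]]|[/eqP //]] := classification charK0 faith_a trans_a alg_a.
(* Since gcd(|k|, 0) = |k|, only k = 1 and k = -1 remain. *)
rewrite gcdn0 in k1; case: k k1 ak => [k|k]; rewrite ?NegzE => /= -[->].
  exact: conjugate_equivalent.
exact: conjugate_tau_opp.
Qed.
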